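(* Let $k$ be an algebraically closed field of characteristic $0$, $n\ge 2$, $S=k[[X_1,\dots,X_n]]$, and let $R=S/I$ be a one-dimensional (Noetherian complete local) domain with fraction field $K$. Assume $I\subseteq (X_1,\dots,X_n)^{2}$. Suppose the integral closure of $R$ in $K$ is $\overline{R}=k[[t]]$ with valuation function $v$. Let $x_i(t)$ denote the image of $X_i$ in $\overline{R}$ and set $x_i'(t)=\frac{d}{dt}x_i(t)$. Let $\mathcal{D}=Rx_1'(t)+\dots+Rx_n'(t)\subseteq K$ and $v(\mathcal{D}^{-1}):=\min\{v(\alpha)\mid \alpha\in K,\ \alpha\mathcal{D}\subseteq R\}$. Then $$h(\Omega_{R/k})=\lambda(\overline{R}/\mathcal{D})-\lambda(\overline{R}/R)+v(\mathcal{D}^{-1})\le v(\mathcal{D}^{-1}).$$ If the rightmost inequality is an equality, then Berger's Conjecture is true for $R$ (i.e. the torsion submodule of $\Omega_{R/k}$ is non-zero).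
   Context: $\lambda(\cdot)$ denotes length as an $R$-module. The valuation function $v$ on $K=k((t))$ assigns to a non-zero series in $t$ the least exponent of $t$ occurring in it ($v(0)=\infty$). Universally finite module of differentials: for $R=S/I$ with $S=k[[X_1,\dots,X_n]]$ and $I=(f_1,\dots,f_m)$, $\Omega_{R/k}$ is the finitely generated $R$-module $\left(\bigoplus_{i=1}^n R\,dX_i\right)/U$, where $U$ is the $R$-submodule generated by $df_j=\sum_{i=1}^n \frac{\partial f_j}{\partial X_i}dX_i$, $j=1,\dots,m$. Invariant $h$: for a Noetherian local one-dimensional domain $R$ and a finitely generated $R$-module $M$ of non-zero rank, $h(M):=\min\{\lambda(R/J)\mid J=\phi(M)\text{ for some }R\text{-homomorphism }\phi:M\to R\}$ (the zero map contributes $\infty$). Berger's Conjecture (domain case): for $k$ perfect and $R$ a complete one-dimensional local $k$-algebra which is a domain, $R$ is regular if and only if the torsion submodule of $\Omega_{R/k}$ is zero. (Under the hypotheses $n\ge2$ and $I\subseteq (X_1,\dots,X_n)^2$, $R$ is not regular.) *)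

(* Defs.v *)
(* The classical axioms of mathcomp.classical.boolp provide decidable equality
   on power series and boolean membership in submodules. *)
From HB Require Import structures.
From mathcomp Require Import all_boot all_order all_algebra.
From mathcomp Require Import boolp mpoly.

Set Implicit Arguments.
Unset Strict Implicit.
Unset Printing Implicit Defensive.

Import Order.TTheory GRing.Theory Num.Theory.
Local Open Scope ring_scope.
Local Open Scope quotient_scope.

Record fps (k : Type) := Fps { fpscoef : nat -> k }.

Section FpsRing.
Variable k : fieldType.
Implicit Types f g h : fps k.

Lemma fpsP f g : fpscoef f =1 fpscoef g -> f = g.
Proof. by case: f g => [f] [g] /= /funext ->. Qed.

HB.instance Definition _ := gen_eqMixin (fps k).
HB.instance Definition _ := gen_choiceMixin (fps k).

Definition fps_const (a : k) : fps k := Fps (fun i => if i == 0%N then a else 0).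
Definition fps_add f g := Fps (fun i => fpscoef f i + fpscoef g i).
Definition fps_opp f := Fps (fun i => - fpscoef f i).
Definition fps_mul f g :=
  Fps (fun i => \sum_(j < i.+1) fpscoef f j * fpscoef g (i - j)%N).

Fact fps_addA : associative fps_add.
Proof. by move=> f g h; apply: fpsP => i; rewrite /= addrA. Qed.
Fact fps_addC : commutative fps_add.
Proof. by move=> f g; apply: fpsP => i; rewrite /= addrC. Qed.
Fact fps_add0 : left_id (fps_const 0) fps_add.
Proof. by move=> f; apply: fpsP => i; rewrite /= if_same add0r. Qed.
Fact fps_addN : left_inverse (fps_const 0) fps_opp fps_add.
Proof. by move=> f; apply: fpsP => i; rewrite /= if_same addNr. Qed.

HB.instance Definition _ :=
  GRing.isZmodule.Build (fps k) fps_addA fps_addC fps_add0 fps_addN.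

(* The polynomial agreeing with f in degrees < N; the ring axioms are
   transported from {poly k} along it. *)
Definition fps_trunc N f : {poly k} := \poly_(i < N) fpscoef f i.

Lemma coef_fps_trunc N f i : (i < N)%N -> (fps_trunc N f)`_i = fpscoef f i.
Proof. by move=> iN; rewrite coef_poly iN. Qed.

Lemma coefM_low (p q p' q' : {poly k}) m :
  (forall i, (i <= m)%N -> p`_i = p'`_i) ->
  (forall i, (i <= m)%N -> q`_i = q'`_i) -> (p * q)`_m = (p' * q')`_m.
Proof.
move=> hp hq; rewrite !coefM; apply: eq_bigr => j _.
by rewrite hp ?hq ?leq_subr // -ltnS.
Qed.

Lemma fps_mul_trunc f g m N : (m < N)%N ->
  fpscoef (fps_mul f g) m = (fps_trunc N f * fps_trunc N g)`_m.
Proof.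
move=> mN; rewrite coefM; apply: eq_bigr => j _.
rewrite !coef_fps_trunc //; first exact: leq_ltn_trans (leq_subr _ _) mN.
by apply: leq_ltn_trans mN; rewrite -ltnS.
Qed.

Fact fps_mulA : associative fps_mul.
Proof.
move=> f g h; apply: fpsP => m.
rewrite !(fps_mul_trunc _ _ (ltnSn m)).
transitivity ((fps_trunc m.+1 f * (fps_trunc m.+1 g * fps_trunc m.+1 h))`_m).
  by apply: coefM_low => // i im; rewrite coef_fps_trunc //
    -?fps_mul_trunc.
rewrite mulrA; apply: coefM_low => // i im.
by rewrite [RHS]coef_fps_trunc // -fps_mul_trunc.
Qed.

Fact fps_mulC : commutative fps_mul.
Proof.
move=> f g; apply: fpsP => m.
by rewrite !(fps_mul_trunc _ _ (ltnSn m)) mulrC.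
Qed.

Fact fps_mul1 : left_id (fps_const 1) fps_mul.
Proof.
move=> f; apply: fpsP => m /=.
rewrite big_ord_recl /= mul1r subn0 big1 ?addr0 // => i _.
by rewrite mul0r.
Qed.

Fact fps_mulDl : left_distributive fps_mul fps_add.
Proof.
move=> f g h; apply: fpsP => m /=.
by rewrite -big_split; apply: eq_bigr => j _; rewrite mulrDl.
Qed.

Fact fps_1_neq0 : fps_const 1 != 0.
Proof.
apply/eqP => /(congr1 (fun f => fpscoef f 0)) /= /eqP.
by rewrite oner_eq0.
Qed.

HB.instance Definition _ := GRing.Zmodule_isComNzRing.Build (fps k)
  fps_mulA fps_mulC fps_mul1 fps_mulDl fps_1_neq0.

Definition fps_unit : {pred fps k} := fun f => `[< exists g, g * f = 1 >].
Definition fps_inv f : fps k :=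
  if pselect (exists g, g * f = 1) is left e then projT1 (cid e) else f.

Fact fps_mulV : {in fps_unit, left_inverse 1 fps_inv *%R}.
Proof.
move=> f /asboolP uf; rewrite /fps_inv; case: pselect => // e.
by case: (cid e).
Qed.
Fact fps_unitP f g : g * f = 1 -> fps_unit f.
Proof. by move=> e; apply/asboolP; exists g. Qed.
Fact fps_inv_out : {in [predC fps_unit], fps_inv =1 id}.
Proof.
move=> f; rewrite inE /= => /asboolPn nuf; rewrite /fps_inv.
by case: pselect.
Qed.

HB.instance Definition _ :=
  GRing.ComNzRing_hasMulInverse.Build (fps k) fps_mulV fps_unitP fps_inv_out.

(* j is the least exponent of t occurring in f *)
Definition fps_order f (j : nat) : Prop :=
  fpscoef f j != 0 /\ forall i, (i < j)%N -> fpscoef f i = 0.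

Lemma fps_order_ex f : f != 0 -> exists j, fps_order f j.
Proof.
move=> nz.
have ex : exists j, fpscoef f j != 0.
  apply: contrapT => nex; move/eqP: nz; apply; apply: fpsP => i /=.
  rewrite if_same; apply/eqP; apply: contrapT => /negP h.
  by apply: nex; exists i.
exists (ex_minn ex); case: ex_minnP => j fj jmin; split=> // i ij.
by apply/eqP; apply: contraLR ij => /jmin; rewrite -leqNgt.
Qed.

Lemma fps_orderM f g a b :
  fps_order f a -> fps_order g b -> fps_order (f * g) (a + b)%N.
Proof.
move=> [fa fl] [gb gl]; split.
  rewrite /= (bigD1 (@Ordinal (a + b).+1 a _)) ?ltnS ?leq_addr //= => ale.
  rewrite addKn big1 ?addr0 ?mulf_neq0 // => j; rewrite -val_eqE /= => ja.
  case: (ltnP j a) => [/fl ->|aj]; first by rewrite mul0r.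
  rewrite gl ?mulr0 // ltn_subLR ?ltn_add2r //; last by rewrite -ltnS.
  by rewrite ltn_neqAle eq_sym ja.
move=> i iab /=; apply: big1 => j _.
case: (ltnP j a) => [/fl ->|aj]; first by rewrite mul0r.
rewrite gl ?mulr0 // ltn_subLR; last by rewrite -ltnS.
by apply: leq_trans iab _; rewrite leq_add2r.
Qed.

Fact fps_idomain : GRing.integral_domain_axiom (fps k).
Proof.
move=> f g fg0; apply: contraT; rewrite negb_or => /andP[].
move=> /fps_order_ex [a fa] /fps_order_ex [b gb].
by have [] := fps_orderM fa gb; rewrite fg0 /= if_same eqxx.
Qed.

HB.instance Definition _ := GRing.ComUnitRing_isIntegral.Build (fps k) fps_idomain.

Definition fps_t : fps k := Fps (fun i => (i == 1%N)%:R).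

Definition fps_deriv f : fps k := Fps (fun i => fpscoef f i.+1 *+ i.+1).

End FpsRing.

(* k((t)), as the fraction field of k[[t]] *)
Notation laurent k := {fraction (fps k)}.

Section Valuation.
Variable k : fieldType.

(* v(z) = d: writing z = t^(-e) f with f in k[[t]], the least exponent of t
   occurring in z is that of f minus e.  No d satisfies this for z = 0, whose
   valuation is infinite. *)
Definition has_val (z : laurent k) (d : int) : Prop :=
  exists (e : nat) (f : fps k) (j : nat),
    [/\ z * tofrac (fps_t k ^+ e) = tofrac f, fps_order f j & d = j%:Z - e%:Z].

Lemma fps_order_uniq (f : fps k) a b : fps_order f a -> fps_order f b -> a = b.
Proof.
move=> [fa la] [fb lb]; apply/eqP; rewrite eqn_leq.
apply/andP; split; rewrite leqNgt; apply/negP.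
  by move=> /la e; rewrite e eqxx in fb.
by move=> /lb e; rewrite e eqxx in fa.
Qed.

Lemma fps_order_tX e : fps_order (fps_t k ^+ e) e.
Proof.
elim: e => [|e IH]; first by split=> [/=|//]; rewrite oner_eq0.
rewrite exprS -add1n; apply: fps_orderM IH.
by split=> [/=|[]//]; rewrite oner_eq0.
Qed.

Lemma fps_order_neq0 (f : fps k) j : fps_order f j -> f != 0.
Proof. by move=> [fj _]; apply: contraNneq fj => -> /=; rewrite if_same. Qed.

Lemma has_val_uniq (z : laurent k) d d' : has_val z d -> has_val z d' -> d = d'.
Proof.
move=> [e [f [j [zf fj ->]]]] [e' [f' [j' [zf' fj' ->]]]].
have E : f * fps_t k ^+ e' = f' * fps_t k ^+ e.
  by apply/eqP; rewrite -tofrac_eq !rmorphM /= -zf -zf' mulrAC.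
have := fps_orderM fj (fps_order_tX e'); rewrite E => /fps_order_uniq.
move=> /(_ _ (fps_orderM fj' (fps_order_tX e))) /(congr1 Posz).
rewrite !PoszD => Ej; apply/eqP; rewrite subr_eq addrAC eq_sym subr_eq.
by rewrite Ej.
Qed.

Lemma has_val_tofrac (f : fps k) j : fps_order f j -> has_val (tofrac f) j.
Proof.
by move=> fj; exists 0%N, f, j; split=> //; rewrite ?subr0 // expr0 rmorph1 mulr1.
Qed.

(* d = min {v(z) | z \in A}; a zero element of A, having infinite valuation,
   does not affect the minimum *)
Definition min_val (A : laurent k -> Prop) (d : int) : Prop :=
  (exists2 z, A z & has_val z d) /\
  (forall z d', A z -> has_val z d' -> d <= d').

Lemma min_val_uniq A d d' : min_val A d -> min_val A d' -> d = d'.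
Proof.
move=> [[z Az vz] m] [[z' Az' vz'] m']; apply/eqP.
by rewrite eq_le (m _ _ Az' vz') (m' _ _ Az vz).
Qed.

End Valuation.

(* 'X_{1..n} is the type of exponent vectors of monomials in n variables. *)
Record mfps (n : nat) (k : Type) := Mfps { mfpscoef : 'X_{1..n} -> k }.

Section MfpsRing.
Variables (n : nat) (k : fieldType).
Local Notation S := (mfps n k).
Implicit Types (f g h : S) (m : 'X_{1..n}).

Lemma mfpsP f g : mfpscoef f =1 mfpscoef g -> f = g.
Proof. by case: f g => [f] [g] /= /funext ->. Qed.

HB.instance Definition _ := gen_eqMixin S.
HB.instance Definition _ := gen_choiceMixin S.

Definition mfps_const (a : k) : S := Mfps (fun m => if m == 0%MM then a else 0).
Definition mfps_add f g : S := Mfps (fun m => mfpscoef f m + mfpscoef g m).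
Definition mfps_opp f : S := Mfps (fun m => - mfpscoef f m).
(* the sum ranges over all the pairs of exponents (p.1, p.2) of sum m, their
   degree being bounded only to make the index type finite, cf. mcoeffM *)
Definition mfps_mul f g : S := Mfps (fun m =>
  \sum_(p : 'X_{1..n < (mdeg m).+1, (mdeg m).+1} | m == (p.1 + p.2)%MM)
     mfpscoef f p.1 * mfpscoef g p.2).

Fact mfps_addA : associative mfps_add.
Proof. by move=> f g h; apply: mfpsP => i; rewrite /= addrA. Qed.
Fact mfps_addC : commutative mfps_add.
Proof. by move=> f g; apply: mfpsP => i; rewrite /= addrC. Qed.
Fact mfps_add0 : left_id (mfps_const 0) mfps_add.
Proof. by move=> f; apply: mfpsP => i; rewrite /= if_same add0r. Qed.
Fact mfps_addN : left_inverse (mfps_const 0) mfps_opp mfps_add.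
Proof. by move=> f; apply: mfpsP => i; rewrite /= if_same addNr. Qed.

HB.instance Definition _ :=
  GRing.isZmodule.Build S mfps_addA mfps_addC mfps_add0 mfps_addN.

Definition mfps_trunc N f : {mpoly k[n]} :=
  \sum_(m : 'X_{1..n < N}) mfpscoef f m *: 'X_[m].

Lemma coef_mfps_trunc N f m :
  (mdeg m < N)%N -> (mfps_trunc N f)@_m = mfpscoef f m.
Proof.
move=> mN; rewrite raddf_sum /= (bigD1 (BMultinom mN)) //= big1.
  by rewrite addr0 linearZ /= mcoeffX eqxx mulr1.
move=> m' m'm; rewrite linearZ /= mcoeffX.
suff -> : (bmnm m' == m) = false by rewrite mulr0.
by apply: contraNF m'm => /eqP e; apply/eqP/val_inj.
Qed.

Lemma mcoeffM_low (p q p' q' : {mpoly k[n]}) m :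
  (forall i, (mdeg i <= mdeg m)%N -> p@_i = p'@_i) ->
  (forall i, (mdeg i <= mdeg m)%N -> q@_i = q'@_i) ->
  (p * q)@_m = (p' * q')@_m.
Proof.
move=> hp hq; rewrite !mcoeffM; apply: eq_bigr => -[i j] _ /=.
by rewrite hp ?hq // -ltnS bmdeg.
Qed.

Lemma mfps_mul_trunc f g m N : (mdeg m < N)%N ->
  mfpscoef (mfps_mul f g) m = (mfps_trunc N f * mfps_trunc N g)@_m.
Proof.
move=> mN; rewrite mcoeffM; apply: eq_bigr => -[i j] _ /=.
by rewrite !coef_mfps_trunc //; apply: leq_trans (bmdeg _) mN.
Qed.

Fact mfps_mulA : associative mfps_mul.
Proof.
move=> f g h; apply: mfpsP => m; set N := (mdeg m).+1.
rewrite !(fun f g => @mfps_mul_trunc f g m N (ltnSn _)).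
transitivity ((mfps_trunc N f * (mfps_trunc N g * mfps_trunc N h))@_m).
  by apply: mcoeffM_low => // i im; rewrite coef_mfps_trunc // -?mfps_mul_trunc.
rewrite mulrA; apply: mcoeffM_low => // i im.
by rewrite [RHS]coef_mfps_trunc // -mfps_mul_trunc.
Qed.

Fact mfps_mulC : commutative mfps_mul.
Proof.
move=> f g; apply: mfpsP => m.
by rewrite !(fun f g => @mfps_mul_trunc f g m _ (ltnSn _)) mulrC.
Qed.

Fact mfps_mul1 : left_id (mfps_const 1) mfps_mul.
Proof.
move=> f; apply: mfpsP => m; set N := (mdeg m).+1.
rewrite (@mfps_mul_trunc _ _ m N (ltnSn _)).
rewrite -[RHS](@coef_mfps_trunc N) // -[mfps_trunc N f in RHS]mul1r.
apply: mcoeffM_low => // i im.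
by rewrite coef_mfps_trunc // mcoeff1 /=; case: eqP.
Qed.

Fact mfps_mulDl : left_distributive mfps_mul mfps_add.
Proof.
move=> f g h; apply: mfpsP => m /=.
by rewrite -big_split; apply: eq_bigr => j _; rewrite mulrDl.
Qed.

Fact mfps_1_neq0 : mfps_const 1 != 0.
Proof.
apply/eqP => /(congr1 (fun f => mfpscoef f 0%MM)) /=.
by rewrite eqxx => /eqP; rewrite oner_eq0.
Qed.

HB.instance Definition _ := GRing.Zmodule_isComNzRing.Build S
  mfps_mulA mfps_mulC mfps_mul1 mfps_mulDl mfps_1_neq0.

Definition mfps_X (i : 'I_n) : S := Mfps (fun m => (m == U_(i)%MM)%:R).

Definition mfps_deriv (i : 'I_n) f : S :=
  Mfps (fun m => mfpscoef f (m + U_(i))%MM *+ (m i).+1).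

End MfpsRing.

Section Submodules.
Variables (R : comNzRingType) (V W : lmodType R).

(* the submodule generated by a finite family: R x_1 + ... + R x_r *)
Definition genmod (J : finType) (x : J -> V) : {pred V} :=
  fun y => `[< exists a : J -> R, y = \sum_j a j *: x j >].

Fact genmod_submod J x : submod_closed (@genmod J x).
Proof.
split; first by apply/asboolP; exists (fun=> 0); rewrite big1 // => j _; rewrite scale0r.
move=> c u v /asboolP[a ->] /asboolP[b ->]; apply/asboolP.
exists (fun j => c * a j + b j); rewrite scaler_sumr -big_split /=.
by apply: eq_bigr => j _; rewrite scalerDl scalerA.
Qed.
HB.instance Definition _ J x :=
  GRing.isSubmodClosed.Build R V (@genmod J x) (genmod_submod x).

Definition image_mod (phi : {linear W -> V}) : {pred V} :=
  fun y => `[< exists x, y = phi x >].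

Fact image_mod_submod phi : submod_closed (image_mod phi).
Proof.
split; first by apply/asboolP; exists 0; rewrite linear0.
move=> c u v /asboolP[a ->] /asboolP[b ->]; apply/asboolP.
by exists (c *: a + b); rewrite linearP.
Qed.
HB.instance Definition _ phi :=
  GRing.isSubmodClosed.Build R V (image_mod phi) (image_mod_submod phi).

End Submodules.

Section QuotientModule.
Variables (R : comNzRingType) (V : lmodType R) (U : submodClosed V).

(* A submodClosed predicate over a ring is closed under opposite, but the
   library does not declare it as a zmodClosed one, which Quotient.quot wants. *)
Definition submod_pred : {pred V} := fun v => v \in U.
Fact submod_pred_zmod : zmod_closed submod_pred.
Proof. exact: (GRing.submod_closedB (submodClosedP U)). Qed.
HB.instance Definition _ :=
  GRing.isZmodClosed.Build V submod_pred submod_pred_zmod.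

Definition quotmod := Quotient.quot submod_pred.

HB.instance Definition _ := GRing.Zmodule.on quotmod.

Definition quotmod_pi (v : V) : quotmod := \pi_(Quotient.quot submod_pred) v.

Definition quotmod_scale (a : R) (x : quotmod) : quotmod :=
  quotmod_pi (a *: repr (x : (Quotient.quot submod_pred))).

Lemma quotmod_scaleE a v : quotmod_scale a (quotmod_pi v) = quotmod_pi (a *: v).
Proof.
apply/eqP; rewrite -Quotient.idealrBE -scalerBr; apply: (@rpredZ _ _ U).
by rewrite -[_ \in U]/(_ \in submod_pred) Quotient.idealrBE reprK.
Qed.

Lemma quotmod_piD u v : quotmod_pi (u + v) = quotmod_pi u + quotmod_pi v.
Proof. exact: (raddfD \pi_(Quotient.quot submod_pred)). Qed.

Lemma quotmod_piK (x : quotmod) : exists v, x = quotmod_pi v.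
Proof. by exists (repr (x : (Quotient.quot submod_pred))); rewrite /quotmod_pi reprK. Qed.

Fact quotmod_scaleA a b x :
  quotmod_scale a (quotmod_scale b x) = quotmod_scale (a * b) x.
Proof. by have [v ->] := quotmod_piK x; rewrite !quotmod_scaleE scalerA. Qed.
Fact quotmod_scale1 : left_id 1 quotmod_scale.
Proof. by move=> x; have [v ->] := quotmod_piK x; rewrite quotmod_scaleE scale1r. Qed.
Fact quotmod_scaleDr : right_distributive quotmod_scale +%R.
Proof.
move=> a x y; have [u ->] := quotmod_piK x; have [v ->] := quotmod_piK y.
by rewrite -quotmod_piD !quotmod_scaleE scalerDr quotmod_piD.
Qed.
Fact quotmod_scaleDl x : {morph quotmod_scale^~ x : a b / a + b}.
Proof.
move=> a b; have [v ->] := quotmod_piK x.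
by rewrite !quotmod_scaleE scalerDl quotmod_piD.
Qed.

HB.instance Definition _ := GRing.Zmodule_isLmodule.Build R quotmod
  quotmod_scaleA quotmod_scale1 quotmod_scaleDr quotmod_scaleDl.

End QuotientModule.

(* B as an R-module through iota : R -> B *)
Definition restr (R B : comNzRingType) (iota : {rmorphism R -> B}) : Type := B.

Section RestrictionOfScalars.
Variables (R B : comNzRingType) (iota : {rmorphism R -> B}).

HB.instance Definition _ := GRing.Zmodule.on (restr iota).

Definition restr_scale (a : R) (x : restr iota) : restr iota :=
  (iota a * (x : B) : B).

Fact restr_scaleA a b x : restr_scale a (restr_scale b x) = restr_scale (a * b) x.
Proof. by rewrite /restr_scale rmorphM mulrA. Qed.
Fact restr_scale1 : left_id 1 restr_scale.
Proof. by move=> x; rewrite /restr_scale rmorph1 mul1r. Qed.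
Fact restr_scaleDr : right_distributive restr_scale +%R.
Proof. by move=> a x y; rewrite /restr_scale; exact: (mulrDr (iota a)). Qed.
Fact restr_scaleDl x : {morph restr_scale^~ x : a b / a + b}.
Proof. by move=> a b; rewrite /restr_scale rmorphD; exact: (@mulrDl B). Qed.

HB.instance Definition _ := GRing.Zmodule_isLmodule.Build R (restr iota)
  restr_scaleA restr_scale1 restr_scaleDr restr_scaleDl.

(* iota as an R-linear map; its image is "R inside B" *)
Definition restr_incl (a : R^o) : restr iota := iota a.

Fact restr_incl_linear : linear restr_incl.
Proof. by move=> a x y; rewrite /restr_incl /= rmorphD rmorphM. Qed.
HB.instance Definition _ :=
  GRing.isLinear.Build R R^o (restr iota) _ restr_incl restr_incl_linear.

End RestrictionOfScalars.
Arguments restr_incl {R B} iota.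

(* c 0 < c 1 < ... < c l, a strict chain of l + 1 subsets *)
Definition strict_chain (T : Type) (c : nat -> {pred T}) (l : nat) : Prop :=
  forall i, (i < l)%N ->
    {subset c i <= c i.+1} /\ exists2 x, x \in c i.+1 & x \notin c i.

(* The module V has finite length l; an infinite length is rendered by
   has_length V l failing for all l. *)
Definition has_length (R : comNzRingType) (V : lmodType R) (l : nat) : Prop :=
  (exists c : nat -> submodClosed V, strict_chain (fun i => c i : {pred V}) l) /\
  (forall (c : nat -> submodClosed V) l',
     strict_chain (fun i => c i : {pred V}) l' -> (l' <= l)%N).

Lemma has_length_uniq (R : comNzRingType) (V : lmodType R) l l' :
  has_length V l -> has_length V l' -> l = l'.
Proof.
move=> [[c cl] ml] [[c' cl'] ml']; apply/eqP.
by rewrite eqn_leq (ml' _ _ cl) (ml _ _ cl').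
Qed.

Definition has_krull_dim (R : comNzRingType) (d : nat) : Prop :=
  (exists c : nat -> prime_idealr R, strict_chain (fun i => c i : {pred R}) d) /\
  (forall (c : nat -> prime_idealr R) d',
     strict_chain (fun i => c i : {pred R}) d' -> (d' <= d)%N).

Definition torsion (R : idomainType) (M : lmodType R) (w : M) : Prop :=
  exists2 r : R, r != 0 & r *: w = 0.

(* h(M) = min {length (R / phi(M)) | phi : M -> R linear}; the phi for which
   R / phi(M) has infinite length do not contribute. *)
Definition h_inv (R : comNzRingType) (M : lmodType R) (h : nat) : Prop :=
  (exists phi : {linear M -> R^o}, has_length (quotmod (image_mod phi)) h) /\
  (forall (phi : {linear M -> R^o}) l,
     has_length (quotmod (image_mod phi)) l -> (h <= l)%N).

Lemma h_inv_uniq (R : comNzRingType) (M : lmodType R) h h' :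
  h_inv M h -> h_inv M h' -> h = h'.
Proof.
move=> [[p pl] m] [[p' pl'] m']; apply/eqP.
by rewrite eqn_leq (m _ _ pl') (m' _ _ pl).
Qed.

Definition gen_ideal (A : comNzRingType) (J : finType) (x : J -> A) : {pred A} :=
  genmod (x : J -> A^o).

Definition maxideal_sq (n : nat) (k : fieldType) : {pred mfps n k} :=
  gen_ideal (fun ij : 'I_n * 'I_n => mfps_X k ij.1 * mfps_X k ij.2).
Arguments maxideal_sq : clear implicits.

Section Differentials.
Variables (n m : nat) (k : fieldType) (R : comNzRingType).
Variables (pi : {rmorphism mfps n k -> R}) (f : 'I_m -> mfps n k).

(* df_j in R dX_1 + ... + R dX_n, identified with the row vectors over R *)
Definition diff_row (j : 'I_m) : 'rV[R]_n := \row_i pi (mfps_deriv i (f j)).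

(* Omega_{R/k} for R = k[[X_1, ..., X_n]] / (f_1, ..., f_m), pi being the
   canonical surjection onto R *)
Definition Omega : lmodType R := quotmod (genmod diff_row).

End Differentials.

Section DerivativeModule.
Variables (n : nat) (k : fieldType) (R : comNzRingType).
Variables (pi : {rmorphism mfps n k -> R}) (iota : {rmorphism R -> fps k}).

Definition param (i : 'I_n) : fps k := iota (pi (mfps_X k i)).

(* D = R x_1'(t) + ... + R x_n'(t), inside the R-module k[[t]] *)
Definition derivmod : {pred restr iota} :=
  genmod (fun i => fps_deriv (param i) : restr iota).
HB.instance Definition _ := GRing.SubmodClosed.on derivmod.

(* the alpha in k((t)) such that alpha D is contained in R *)
Definition derivmod_inv (alpha : laurent k) : Prop :=
  forall y : fps k, (y : restr iota) \in derivmod ->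
    exists r : R, alpha * tofrac y = tofrac (iota r).

End DerivativeModule.
Arguments derivmod {n k R} pi iota.

(* Main.v *)
Require Import Defs.
From HB Require Import structures.
From mathcomp Require Import all_boot all_order all_algebra.
From mathcomp Require Import boolp mpoly ring zify.

Set Implicit Arguments.
Unset Strict Implicit.
Unset Printing Implicit Defensive.

Import Order.TTheory GRing.Theory Num.Theory.
Local Open Scope ring_scope.

(** Write x_i for the image of X_i in B = k[[t]], and let delta be the map from
    Omega onto D that sends dX_i to x_i'.

    The conductor. Since t is a quotient of two elements of R, the orders of
    the elements of R include all large integers; by completeness, R then
    contains t^c B for some c (subst_conductor). The same holds for D and, with
    a larger c, for the nonzero ideals of R; the length of a quotient of two
    such modules is the number of orders attained in the larger one and not in
    the smaller one (has_length_count).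

    The homomorphisms Omega -> R. They are the k-derivations R -> R. Such a
    derivation extends to k[[t]] with denominator t^c
    (conductor_derivation), and a k-derivation of k[[t]] is a multiple of d/dt,
    because k[[t]] = k + t k[[t]] forces a derivation killing k and t to take
    infinitely divisible values (fps_derivation_eq). Hence the homomorphisms
    are the maps alpha delta with alpha in D^-1. The values of the image
    alpha D are those of D shifted by v(alpha), and counting gaps gives
    length(R / alpha D) = length(B / D) - length(B / R) + v(alpha)
    (length_image). Minimising v(alpha) gives the formula for h(Omega).

    The inequality. Differentiation maps R into D by the chain rule and, in
    characteristic 0, lowers positive orders by one, so that each gap e of D
    comes from the gap e + 1 of R (length_derivmod_le).

    The equality case. If there are as many gaps on both sides, then D has the
    same orders as the space of derivatives of elements of R, and equals it
    (derivmod_exact). In particular x_1 x_2' - x_2 x_1' = r' for some r in R,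
    and w = X_1 dX_2 - X_2 dX_1 - dr is in the kernel of delta. This kernel is
    torsion: over the fraction field Omega has dimension 1, because a linear
    form on it is a multiple of delta (delta_kernel_torsion). Finally w is
    nonzero: as I lies in the square of the maximal ideal, a combination of
    the relations df_j has an exterior derivative vanishing at the origin,
    whereas that of w is 2 dX_1 dX_2 there (rotation_not_exact). *)

(** * Derivations along a map *)

Definition derivation_along (A B : comNzRingType) (s D : A -> B) : Prop :=
  {morph D : x y / x + y} /\ forall x y, D (x * y) = s x * D y + s y * D x.

Section DerivationAlong.
Variables (A B : comNzRingType) (s D : A -> B).
Hypothesis der : derivation_along s D.

Lemma derivation_along0 : D 0 = 0.
Proof. by apply: (addrI (D 0)); rewrite -der.1 !addr0. Qed.

Lemma derivation_alongB x y : D (x - y) = D x - D y.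
Proof. by apply: (addIr (D y)); rewrite -der.1 !subrK. Qed.

Lemma derivation_along_sum (I : Type) (r : seq I) (F : I -> A) :
  D (\sum_(x <- r) F x) = \sum_(x <- r) D (F x).
Proof. exact: (big_morph D der.1 derivation_along0). Qed.

End DerivationAlong.

(** * Orders of power series in one variable *)

Section Order.
Variable k : fieldType.
Local Notation B := (fps k).
Local Notation t := (fps_t k).
Implicit Types (f g p : B) (a b c d e i j q N : nat).

Definition ordge N f : Prop := forall i, (i < N)%N -> fpscoef f i = 0.

Lemma fpscoef0 i : fpscoef (0 : B) i = 0.
Proof. by rewrite /= if_same. Qed.

Lemma fpscoefD f g i : fpscoef (f + g) i = fpscoef f i + fpscoef g i.
Proof. by []. Qed.

Lemma fpscoefB f g i : fpscoef (f - g) i = fpscoef f i - fpscoef g i.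
Proof. by []. Qed.

Lemma fpscoefZ (c : k) f i : fpscoef (fps_const c * f) i = c * fpscoef f i.
Proof.
rewrite /= big_ord_recl /= subn0 big1 ?addr0 // => j _.
by rewrite mul0r.
Qed.

Lemma fpscoef0M f g : fpscoef (f * g) 0 = fpscoef f 0 * fpscoef g 0.
Proof. by rewrite /= big_ord_recl big_ord0 addr0. Qed.

Lemma fpscoef_tM f i :
  fpscoef (t * f) i = if i is j.+1 then fpscoef f j else 0.
Proof.
case: i => [|i]; first by rewrite fpscoef0M mul0r.
rewrite /= big_ord_recl big_ord_recl /= mul0r add0r mul1r subn1.
by rewrite big1 ?addr0 // => j _; rewrite mul0r.
Qed.

Lemma fpscoef_tXM N f i :
  fpscoef (t ^+ N * f) i = if (i < N)%N then 0 else fpscoef f (i - N).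
Proof.
elim: N i => [|N IH] i; first by rewrite expr0 mul1r subn0.
by rewrite exprS -mulrA fpscoef_tM; case: i.
Qed.

Lemma ordge_le a b f : (a <= b)%N -> ordge b f -> ordge a f.
Proof. by move=> ab fb i ia; apply: fb; apply: leq_trans ab. Qed.

Lemma ordge0 f : ordge 0 f.
Proof. by []. Qed.

Lemma ordge_zero N : ordge N 0.
Proof. by move=> i _; rewrite fpscoef0. Qed.

Lemma ordge_tX N : ordge N (t ^+ N).
Proof. by case: (fps_order_tX k N). Qed.

Lemma ordgeD N f g : ordge N f -> ordge N g -> ordge N (f + g).
Proof. by move=> hf hg i iN; rewrite fpscoefD hf ?hg ?addr0. Qed.

Lemma ordgeB N f g : ordge N f -> ordge N g -> ordge N (f - g).
Proof. by move=> hf hg i iN; rewrite fpscoefB hf ?hg ?subr0. Qed.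

Lemma ordge_sum (I : Type) (r : seq I) (P : pred I) (F : I -> B) N :
  (forall x, P x -> ordge N (F x)) -> ordge N (\sum_(x <- r | P x) F x).
Proof.
by move=> h; elim/big_ind: _ => //; [exact: ordge_zero | exact: ordgeD].
Qed.

Lemma ordgeM a b f g : ordge a f -> ordge b g -> ordge (a + b) (f * g).
Proof.
move=> hf hg i iab /=; apply: big1 => j _.
case: (ltnP j a) => [/hf ->|aj]; first by rewrite mul0r.
rewrite hg ?mulr0 //; have := ltn_ord j; lia.
Qed.

Lemma ordge_eq0 f : (forall N, ordge N f) -> f = 0.
Proof. by move=> h; apply: fpsP => i; rewrite fpscoef0 (h i.+1). Qed.

Lemma order_ordge f d : fps_order f d -> ordge d f.
Proof. by case. Qed.

Lemma ordge_order N f d : ordge N f -> fps_order f d -> (N <= d)%N.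
Proof.
move=> hf [nz _]; rewrite leqNgt; apply/negP => dN.
by rewrite hf ?eqxx in nz.
Qed.

Lemma ordge_t N f : ordge N f -> exists g, f = t ^+ N * g.
Proof.
move=> hf; exists (Fps (fun i => fpscoef f (N + i))); apply: fpsP => i.
rewrite fpscoef_tXM; case: ltnP => [/hf //|Ni] /=.
by rewrite subnKC.
Qed.

Lemma order_addge f g d : fps_order f d -> ordge d.+1 g -> fps_order (f + g) d.
Proof.
move=> [nz lo] hg; split; first by rewrite fpscoefD hg ?addr0.
by move=> i id; rewrite fpscoefD lo // hg ?addr0 // ltnW.
Qed.

(** Greedy expansion: a family with one series of each order d >= c expands
    every series of order at least c, the coefficients being read off from the
    successive leading terms. *)
Lemma order_family_expand c (e : nat -> B) f :
  (forall j, fps_order (e j) (c + j)) -> ordge c f ->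
  exists la : nat -> k, forall N,
    ordge (c + N) (f - \sum_(j < N) fps_const (la j) * e j).
Proof.
move=> he hf.
pose lead j g := fpscoef g (c + j) / fpscoef (e j) (c + j).
pose rest := fix rest j :=
  if j is j'.+1 then rest j' - fps_const (lead j' (rest j')) * e j' else f.
exists (fun j => lead j (rest j)) => N.
have -> : f - \sum_(j < N) fps_const (lead j (rest j)) * e j = rest N.
  elim: N => [|N IH]; first by rewrite big_ord0 subr0.
  by rewrite big_ord_recr /= opprD addrA IH.
have restS j : rest j.+1 = rest j - fps_const (lead j (rest j)) * e j by [].
elim: N => [|N IH]; first by rewrite addn0.
move=> i; rewrite addnS ltnS leq_eqVlt => /orP[/eqP->|iN]; rewrite restS.
  rewrite fpscoefB fpscoefZ /lead -mulrA mulVf ?mulr1 ?subrr //.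
  by case: (he N).
by rewrite fpscoefB fpscoefZ IH // (order_ordge (he N)) // mulr0 subr0.
Qed.

(** Subtracting a scalar multiple of an element of the smaller space raises the
    order of an element of the larger one; once the order is at least c, the
    element is known to lie in the smaller space. *)
Lemma same_orders_sub (P Q : B -> Prop) c :
  (forall f g (a : k), P f -> P g -> P (f + fps_const a * g)) ->
  (forall f g (a : k), Q f -> Q g -> Q (f + fps_const a * g)) ->
  (forall f, P f -> Q f) -> (forall f, Q f -> ordge c f -> P f) ->
  (forall d f, (d < c)%N -> Q f -> fps_order f d ->
     exists2 g, P g & fps_order g d) ->
  forall f, Q f -> P f.
Proof.
move=> Plin Qlin PQ Pc PV.
suff H N f : Q f -> ordge (c - N) f -> P f.
  by move=> f Qf; apply: (H c f Qf); rewrite subnn.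
elim: N f => [|N IH] f Qf hf; first by apply: Pc; rewrite // subn0 in hf *.
case: (leqP c N) => [cN|Nc]; first by apply: IH => //; move: hf; congr ordge; lia.
set d := (c - N.+1)%N in hf.
have [f0|f0] := eqVneq (fpscoef f d) 0.
  apply: IH => // i iN; case: (ltnP i d) => [/hf //|di].
  by have -> : i = d by rewrite /d in di *; lia.
have [|g Pg [g0 gl]] := PV d f _ Qf (conj f0 hf); first by rewrite /d; lia.
pose a := fpscoef f d / fpscoef g d.
have -> : f = (f + fps_const (- a) * g) + fps_const a * g.
  rewrite -addrA -mulrDl [fps_const _ + _](_ : _ = 0) ?mul0r ?addr0 //.
  by apply: fpsP => i /=; case: ifP; rewrite ?addNr ?addr0.
apply: Plin => //; apply: IH; first by apply: Qlin; last exact: PQ.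
move=> i iN; rewrite fpscoefD fpscoefZ.
case: (ltnP i d) => [id|di]; first by rewrite (hf i id) (gl i id) mulr0 addr0.
have -> : i = d by rewrite /d in di *; lia.
by rewrite mulNr divfK ?subrr.
Qed.

Lemma fps_expand f N :
  ordge N (f - \sum_(i < N) fps_const (fpscoef f i) * t ^+ i).
Proof.
suff E M i : fpscoef (\sum_(j < M) fps_const (fpscoef f j) * t ^+ j) i =
    if (i < M)%N then fpscoef f i else 0.
  by move=> i iN; rewrite fpscoefB E iN subrr.
elim: M => [|M IH]; first by rewrite big_ord0 fpscoef0.
rewrite big_ord_recr fpscoefD IH fpscoefZ -[t ^+ M]mulr1 fpscoef_tXM ltnS.
case: (ltngtP i M) => [iM|Mi|->]; rewrite ?mulr0 ?addr0 ?subnn ?mulr1 ?add0r //.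
by rewrite /= subn_eq0 leqNgt Mi mulr0.
Qed.

Lemma fps_divide p f q N : fps_order p q -> ordge (q + N) f ->
  exists2 g, ordge N g & f = p * g.
Proof.
move=> pq hf.
have he j : fps_order (p * t ^+ (N + j)) (q + N + j).
  by rewrite -addnA; apply: fps_orderM => //; apply: fps_order_tX.
have [la hla] := order_family_expand he hf.
pose g := Fps la; exists (t ^+ N * g).
  by move=> i iN; rewrite fpscoef_tXM iN.
apply/eqP; rewrite -subr_eq0; apply/eqP/ordge_eq0 => M.
have -> : f - p * (t ^+ N * g) =
    (f - \sum_(j < M) fps_const (la j) * (p * t ^+ (N + j))) -
    p * t ^+ N * (g - \sum_(j < M) fps_const (fpscoef g j) * t ^+ j).
  rewrite mulrBr opprB mulrA addrA -[X in _ = X - _]addrA; congr (_ - _).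
  rewrite mulr_sumr [X in _ = _ + X]addrC -sumrB big1 ?addr0 // => j _.
  by rewrite exprD; ring.
apply: ordgeB; first by apply: ordge_le (hla M); rewrite leq_addl.
by apply: ordge_le (ordgeM (@ordge0 _) (@fps_expand g M)); rewrite leq_addl.
Qed.

(** * Derivations of k[[t]] *)

Lemma fps_derivD f g : fps_deriv (f + g) = fps_deriv f + fps_deriv g.
Proof. by apply: fpsP => i; rewrite /= mulrnDl. Qed.

Lemma fps_derivM f g :
  fps_deriv (f * g) = f * fps_deriv g + g * fps_deriv f.
Proof.
have truncD h m N : (m.+1 < N)%N ->
    ((fps_trunc N h)^`())%R`_m = fpscoef (fps_deriv h) m.
  by move=> mN; rewrite coef_deriv coef_fps_trunc.
apply: fpsP => m; pose N := m.+2.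
rewrite [LHS]/= -/(fps_mul f g) -[LHS]/(fpscoef (fps_mul f g) m.+1 *+ m.+1).
rewrite (@fps_mul_trunc _ f g m.+1 N) // -coef_deriv derivM coefD addrC.
rewrite fpscoefD -[fpscoef (f * _) m]/(fpscoef (fps_mul f _) m).
rewrite -[fpscoef (g * _) m]/(fpscoef (fps_mul g _) m).
rewrite !(@fps_mul_trunc _ _ _ m m.+1) // [(_ * fps_trunc N g)%R]mulrC.
by congr (_ + _); apply: coefM_low => i im;
  rewrite ?truncD ?coef_fps_trunc //; lia.
Qed.

Lemma fps_derivC (c : k) : fps_deriv (fps_const c) = 0.
Proof. by apply: fpsP => i; rewrite /= if_same mul0rn. Qed.

Lemma fps_deriv_t : fps_deriv t = 1.
Proof. by apply: fpsP => -[|i] //=; rewrite mul0rn. Qed.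

(** Writing f = f(0) + t f1 shows that a derivation killing the constants and
    t maps f to t times a value of itself, so that all its values are
    infinitely divisible by t. *)
Lemma fps_derivation_eq (D : B -> B) :
  derivation_along id D -> (forall c : k, D (fps_const c) = 0) ->
  forall f, D f = D t * fps_deriv f.
Proof.
move=> der Dc f; apply/eqP; rewrite -subr_eq0; apply/eqP.
pose E g := D g - D t * fps_deriv g; rewrite -/(E f).
have Et g : E (t * g) = t * E g.
  by rewrite /E der.2 fps_derivM fps_deriv_t; ring.
have ED x y : E (x + y) = E x + E y.
  by rewrite /E der.1 fps_derivD; ring.
have Ec (c : k) : E (fps_const c) = 0 by rewrite /E Dc fps_derivC mulr0 subrr.
apply: ordge_eq0 => N; elim: N f => // N IH f.
have [g fg] : exists g, f - fps_const (fpscoef f 0) = t ^+ 1 * g.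
  by apply: ordge_t => -[|] //= _; rewrite subrr.
rewrite -(subrK (fps_const (fpscoef f 0)) f) ED Ec addr0 fg expr1 Et.
by rewrite -add1n; apply: ordgeM (IH g); rewrite -[t]expr1; apply: ordge_tX.
Qed.

Hypothesis k_char0 : [pchar k] =i pred0.

Lemma pchar0_natr_neq0 j : j.+1%:R != 0 :> k.
Proof. by have /pcharf0P -> := k_char0. Qed.

Lemma order_deriv f d : fps_order f d.+1 -> fps_order (fps_deriv f) d.
Proof.
move=> [nz lo]; split; last by move=> i id /=; rewrite lo ?mul0rn.
by rewrite /= -mulr_natr mulf_neq0 // pchar0_natr_neq0.
Qed.

Lemma fps_primitive N f : ordge N f ->
  exists2 g, ordge N.+1 g & fps_deriv g = f.
Proof.
move=> hf.
exists (Fps (fun i => if i is j.+1 then fpscoef f j / j.+1%:R else 0)).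
  by move=> [|i] //= iN; rewrite hf ?mul0r.
apply: fpsP => i /=; by rewrite -[LHS]mulr_natr divfK // pchar0_natr_neq0.
Qed.

End Order.

(** * Orders and partial derivatives of power series in several variables *)

Section MultiOrder.
Variables (n : nat) (k : fieldType).
Local Notation S := (mfps n k).
Implicit Types (F G : S) (m : 'X_{1..n}) (i j : 'I_n) (a b N : nat).

Definition mordge N F : Prop := forall m, (mdeg m < N)%N -> mfpscoef F m = 0.

Lemma mfpscoef0 m : mfpscoef (0 : S) m = 0.
Proof. by rewrite /= if_same. Qed.

Lemma mfpscoefD F G m : mfpscoef (F + G) m = mfpscoef F m + mfpscoef G m.
Proof. by []. Qed.

Lemma mfpscoefB F G m : mfpscoef (F - G) m = mfpscoef F m - mfpscoef G m.
Proof. by []. Qed.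

Lemma mfpscoef_sum (I : Type) (r : seq I) (P : pred I) (F : I -> S) m :
  mfpscoef (\sum_(x <- r | P x) F x) m = \sum_(x <- r | P x) mfpscoef (F x) m.
Proof.
exact: (big_morph (fun G => mfpscoef G m) (fun G H => mfpscoefD G H m)
          (mfpscoef0 m)).
Qed.

Lemma mordge_le a b F : (a <= b)%N -> mordge b F -> mordge a F.
Proof. by move=> ab hF m ma; apply: hF; apply: leq_trans ab. Qed.

Lemma mordgeM a b F G : mordge a F -> mordge b G -> mordge (a + b) (F * G).
Proof.
move=> hF hG m mab /=; apply: big1 => -[p q] /= /eqP E.
have := congr1 mdeg E; rewrite mdegD => Em.
case: (ltnP (mdeg p) a) => [/hF ->|ap]; first by rewrite mul0r.
by rewrite hG ?mulr0 //; lia.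
Qed.

Lemma mordgeX N F : mordge 1 F -> mordge N (F ^+ N).
Proof.
move=> hF; elim: N => [|N IH]; first by [].
by rewrite exprS -add1n; apply: mordgeM.
Qed.

Lemma mordge_X i : mordge 1 (mfps_X k i).
Proof.
move=> m; rewrite ltnS leqn0 mdeg_eq0 => /eqP ->.
by rewrite /= eq_sym mnm1_eq0.
Qed.

Lemma mfpscoefC (c : k) F m : mfpscoef (mfps_const n c * F) m = c * mfpscoef F m.
Proof.
rewrite [LHS](@mfps_mul_trunc _ _ _ _ m (mdeg m).+1) //.
transitivity ((c%:MP * mfps_trunc (mdeg m).+1 F)@_m).
  apply: mcoeffM_low => // m' m'm; rewrite coef_mfps_trunc //=.
  by rewrite mcoeffC; case: eqP; rewrite ?mulr1 ?mulr0.
by rewrite mcoeffCM coef_mfps_trunc.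
Qed.

Lemma mfpscoef0M F G : mfpscoef (F * G) 0%MM = mfpscoef F 0%MM * mfpscoef G 0%MM.
Proof.
rewrite [LHS](@mfps_mul_trunc _ _ _ _ 0%MM 1) ?mdeg0 //.
rewrite (rmorphM (mcoeff 0%MM)) /= !coef_mfps_trunc ?mdeg0 //.
Qed.

Lemma mfpscoef_XM i F m :
  mfpscoef (mfps_X k i * F) m =
  if (0 < m i)%N then mfpscoef F (m - U_(i))%MM else 0.
Proof.
rewrite [LHS](@mfps_mul_trunc _ _ _ _ m (mdeg m).+1) //.
transitivity ((mfps_trunc (mdeg m).+1 F * 'X_i)@_m).
  rewrite mulrC; apply: mcoeffM_low => // m' m'm; rewrite coef_mfps_trunc //=.
  by rewrite mcoeffX eq_sym.
case: ifP => [mi|/negbT].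
  have Em : m = (U_(i) + (m - U_(i)))%MM.
    apply/mnmP => j; rewrite mnmDE mnmBE mnm1E; case: eqP => [<-|_]; lia.
  set T := mfps_trunc _ _; rewrite [in LHS]Em mcoeffMX coef_mfps_trunc //.
  by rewrite ltnS; apply: mdegB.
rewrite -leqNgt leqn0 => /eqP mi; rewrite mcoeffM big1 // => -[p q] /= /eqP E.
rewrite mcoeffX; case: eqP => [Eq|_]; last by rewrite mulr0.
have := congr1 (fun m : 'X_{1..n} => m i) E.
by rewrite mi /= -Eq mnmDE mnm1E eqxx addn1.
Qed.

Lemma mfps_derivD i F G :
  mfps_deriv i (F + G) = mfps_deriv i F + mfps_deriv i G.
Proof. by apply: mfpsP => m; rewrite /= mulrnDl. Qed.

Lemma mfps_derivM i F G :
  mfps_deriv i (F * G) = F * mfps_deriv i G + G * mfps_deriv i F.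
Proof.
have truncD H m N : ((mdeg m).+1 < N)%N ->
    ((mfps_trunc N H)^`M(i))@_m = mfpscoef (mfps_deriv i H) m.
  by move=> mN; rewrite mcoeff_deriv coef_mfps_trunc // mdegD mdeg1 addn1.
apply: mfpsP => m; pose N := (mdeg m).+2.
rewrite -[LHS]/(mfpscoef (mfps_mul F G) (m + U_(i))%MM *+ (m i).+1).
rewrite (@mfps_mul_trunc _ _ F G _ N) ?mdegD ?mdeg1 ?addn1 //.
rewrite -mcoeff_deriv mderivM mcoeffD addrC mfpscoefD.
rewrite -[mfpscoef (F * _) m]/(mfpscoef (mfps_mul F _) m).
rewrite -[mfpscoef (G * _) m]/(mfpscoef (mfps_mul G _) m).
rewrite !(@mfps_mul_trunc _ _ _ _ m (mdeg m).+1) // [_ * mfps_trunc N G]mulrC.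
by congr (_ + _); apply: mcoeffM_low => m' m'm;
  rewrite ?truncD ?coef_mfps_trunc //; lia.
Qed.

Lemma mfps_deriv_derivation i : derivation_along id (@mfps_deriv n k i).
Proof. by split; [exact: mfps_derivD | exact: mfps_derivM]. Qed.

Lemma mfps_derivC i (c : k) : mfps_deriv i (mfps_const n c) = 0.
Proof.
by apply: mfpsP => m; rewrite /= mnmD_eq0 mnm1_eq0 andbF mul0rn if_same.
Qed.

Lemma mfps_deriv_X i j : mfps_deriv i (mfps_X k j) = (i == j)%:R.
Proof.
have -> : ((i == j)%:R : S) = mfps_const n (i == j)%:R.
  by case: (i == j) => //; apply: mfpsP => m; rewrite /= if_same.
apply: mfpsP => m /=; case: (eqVneq m 0%MM) => [->|m0].
  rewrite add0m mnm0E mulr1n; congr (nat_of_bool _)%:R.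
  apply/eqP/eqP => [/(congr1 (fun m : 'X_{1..n} => m j))|-> //].
  by rewrite !mnm1E eqxx; case: eqP.
case: eqP => [E|_]; last by rewrite mul0rn.
move: m0; rewrite -mdeg_eq0; have := congr1 mdeg E.
by rewrite mdegD !mdeg1; lia.
Qed.

Lemma mfps_deriv_comm0 i j F : i != j ->
  mfpscoef (mfps_deriv i (mfps_deriv j F)) 0%MM =
  mfpscoef (mfps_deriv j (mfps_deriv i F)) 0%MM.
Proof.
move=> /negbTE ij /=; rewrite !add0m !mnm1E !mnm0E [j == i]eq_sym ij.
by rewrite addmC.
Qed.

Lemma mfps_deriv_mordge i N F : mordge N.+1 F -> mordge N (mfps_deriv i F).
Proof.
by move=> hF m mN; rewrite /= hF ?mul0rn // mdegD mdeg1 addn1 ltnS.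
Qed.

Hypothesis k_char0 : [pchar k] =i pred0.

(** The Euler formula sum_i X_i d_i F = d F in degree d gives a choice of the
    G_i that treats all the variables alike, and visibly drops the order by
    one. *)
Lemma mfps_decomp F : exists G : 'I_n -> S,
  F = mfps_const n (mfpscoef F 0%MM) + \sum_i mfps_X k i * G i /\
  forall N, mordge N.+1 F -> forall i, mordge N (G i).
Proof.
exists (fun i => Mfps (fun m =>
  mfpscoef (mfps_deriv i F) m / (mdeg m).+1%:R)); split; last first.
  by move=> N hF i m mN; apply/eqP; rewrite mulf_eq0 (mfps_deriv_mordge i hF) ?eqxx.
apply: mfpsP => m; rewrite mfpscoefD mfpscoef_sum.
under eq_bigr do rewrite mfpscoef_XM.
case: (eqVneq m 0%MM) => [->|m0] /=.
  by rewrite eqxx big1 ?addr0 // => i _; rewrite mnm0E.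
rewrite (negbTE m0) add0r.
have dm : (mdeg m)%:R != 0 :> k.
  by case: (mdeg m) (mdeg_eq0 m) => [|d _]; rewrite ?(negbTE m0) ?pchar0_natr_neq0.
transitivity (\sum_i mfpscoef F m * (m i)%:R / (mdeg m)%:R); last first.
  apply: eq_bigr => i _; case: (posnP (m i)) => [->|mi].
    by rewrite mulr0 mul0r.
  have Em : (m - U_(i) + U_(i))%MM = m.
    by apply/mnmP => j; rewrite mnmDE mnmBE mnm1E; case: eqP => [<-|_]; lia.
  rewrite mnmBE mnm1E eqxx subn1 prednK // Em mulr_natr.
  by have := congr1 mdeg Em; rewrite mdegD mdeg1 addn1 => ->.
by rewrite -mulr_suml -mulr_sumr -natr_sum -mdegE mulfK.
Qed.

End MultiOrder.

(** * Substitution of power series in t *)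

Section Substitution.
Variables (n : nat) (k : fieldType).
Hypothesis k_char0 : [pchar k] =i pred0.
Local Notation S := (mfps n k).
Local Notation B := (fps k).
Local Notation t := (fps_t k).
Variable sigma : {rmorphism S -> B}.
Hypothesis sigma_const : forall c : k, sigma (mfps_const n c) = fps_const c.
Implicit Types (F G : S) (N d : nat).

(** If X_i were sent to a series with constant term a <> 0, then sigma would
    send the unit X_i - a, whose inverse is a geometric series, to a multiple
    of t. *)
Lemma subst_X_ordge i : ordge 1 (sigma (mfps_X k i)).
Proof.
move=> [|//] _; set a := fpscoef _ _; apply/eqP; apply: contraT => a0.
pose G : S := Mfps (fun m =>
  if m == (U_(i) *+ m i)%MM then - a ^- (m i).+1 else 0).
have XG : (mfps_X k i - mfps_const n a) * G = 1.
  apply: mfpsP => m; rewrite mulrBl mfpscoefB mfpscoef_XM mfpscoefC.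
  case: (posnP (m i)) => [mi|mi]; last first.
    have Em : (m == (U_(i) *+ m i)%MM) =
              ((m - U_(i))%MM == (U_(i) *+ (m - U_(i))%MM i)%MM).
      have mi1 : (m - U_(i))%MM i = (m i).-1 by rewrite mnmBE mnm1E eqxx subn1.
      apply/eqP/eqP => /mnmP E; apply/mnmP => j; have := E j;
        rewrite mi1 !(mnmBE, mulmnE, mnm1E); case: eqP => [<-|]; lia.
    have m0 : (m == 0%MM) = false.
      by apply/eqP => E; rewrite E mnm0E in mi.
    rewrite /= -Em m0 mnmBE mnm1E eqxx subn1 prednK //.
    case: ifP => _; last by rewrite mulr0 subrr.
    by rewrite mulrN opprK exprS invfM mulVKf // addNr.
  rewrite sub0r /= mi mulm0n expr1; case: eqP => [_|_].
    by rewrite mulrN opprK divff.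
  by rewrite mulr0 oppr0.
have := congr1 (fun f => fpscoef (sigma f) 0) XG.
rewrite rmorphM rmorphB rmorph1 sigma_const fpscoef0M fpscoefB /= -/a subrr mul0r.
by move/eqP; rewrite eq_sym oner_eq0.
Qed.

Lemma subst_ordge N F : mordge N F -> ordge N (sigma F).
Proof.
elim: N F => [//|N IH] F hF.
have [G [EF hG]] := mfps_decomp k_char0 F.
rewrite EF hF ?mdeg0 // rmorphD /= sigma_const.
apply: ordgeD; first by move=> i _; rewrite /= if_same.
rewrite rmorph_sum; apply: ordge_sum => i _ /=; rewrite rmorphM -add1n.
by apply: ordgeM; [exact: subst_X_ordge | exact/IH/hG].
Qed.

Lemma subst_coef0 F : fpscoef (sigma F) 0 = mfpscoef F 0%MM.
Proof.
have h : mordge 1 (F - mfps_const n (mfpscoef F 0%MM)).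
  move=> m; rewrite ltnS leqn0 mdeg_eq0 => /eqP ->.
  by rewrite mfpscoefB /= eqxx subrr.
have := subst_ordge h (ltnSn 0); rewrite rmorphB /= sigma_const => /eqP.
by rewrite subr_eq0 => /eqP.
Qed.

(** As in one variable, F = F(0) + sum_i X_i G_i makes all the values of a
    derivation killing the X_i infinitely divisible by t. *)
Lemma subst_derivation_eq0 (D : S -> B) :
  derivation_along sigma D -> (forall c : k, D (mfps_const n c) = 0) ->
  (forall i, D (mfps_X k i) = 0) -> forall F, D F = 0.
Proof.
move=> der Dc DX F; apply: ordge_eq0 => N; elim: N F => // N IH F.
have [G [-> _]] := mfps_decomp k_char0 F.
rewrite der.1 Dc add0r (derivation_along_sum der).
apply: ordge_sum => i _; rewrite der.2 DX mulr0 addr0 -add1n.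
by apply: ordgeM (IH _); exact: subst_X_ordge.
Qed.

Lemma subst_chain_rule F :
  fps_deriv (sigma F) =
  \sum_i sigma (mfps_deriv i F) * fps_deriv (sigma (mfps_X k i)).
Proof.
pose D G := fps_deriv (sigma G) -
  \sum_i sigma (mfps_deriv i G) * fps_deriv (sigma (mfps_X k i)).
suff D0 : D F = 0 by apply/eqP; rewrite -subr_eq0; apply/eqP.
apply: subst_derivation_eq0 => [|c|j]; rewrite {}/D.
- split=> x y /=.
    rewrite rmorphD fps_derivD [RHS]addrACA -opprD -big_split /=.
    by congr (_ - _); apply: eq_bigr => i _; rewrite mfps_derivD rmorphD mulrDl.
  rewrite rmorphM fps_derivM !mulrBr [RHS]addrACA -opprD !mulr_sumr -big_split /=.
  congr (_ - _); apply: eq_bigr => i _; rewrite mfps_derivM rmorphD !rmorphM.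
  by ring.
- rewrite sigma_const fps_derivC sub0r big1 ?oppr0 // => i _.
  by rewrite mfps_derivC rmorph0 mul0r.
rewrite (bigD1 j) //= big1 => [|i ij]; rewrite mfps_deriv_X.
  by rewrite eqxx rmorph1 mul1r addr0 subrr.
by rewrite (negbTE ij) rmorph0 mul0r.
Qed.

(** The analogue of the completeness of R: sigma is onto from order c on as
    soon as its image has elements of all orders >= c, coming from elements
    F_j of S tending to 0. The coefficient of m in the sum of the la_j F_j is
    a finite sum since F_j has no monomial of degree < j / s. *)
Lemma subst_surj (s c : nat) (F : nat -> S) : (0 < s)%N ->
  (forall j, mordge (j %/ s) (F j)) ->
  (forall j, fps_order (sigma (F j)) (c + j)) ->
  forall y, ordge c y -> exists G, sigma G = y.
Proof.
move=> s0 loF oF y /(order_family_expand oF) [la hla].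
pose P N : S := \sum_(j < N) mfps_const n (la j) * F j.
pose G : S := Mfps (fun m => mfpscoef (P (s * (mdeg m).+1)%N) m).
have GP N : mordge N (G - P (s * N)%N).
  move=> m mN; rewrite mfpscoefB /= !mfpscoef_sum.
  set a := (s * _)%N; set b := (s * N)%N.
  have ab : (a <= b)%N by rewrite leq_pmul2l.
  pose T j := mfpscoef (mfps_const n (la j) * F j) m.
  rewrite -(big_mkord xpredT T) -[X in _ - X](big_mkord xpredT T).
  rewrite (big_cat_nat (leq0n a) ab) /= opprD addrA subrr sub0r.
  rewrite big_nat big1 ?oppr0 // => j /andP[aj _].
  rewrite /T mfpscoefC (loF j) ?mulr0 //.
  by rewrite leq_divRL // mulnC.
exists G; apply/eqP; rewrite -subr_eq0; apply/eqP/ordge_eq0 => N.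
have -> : sigma G - y = sigma (G - P (s * N)%N) -
    (y - \sum_(j < s * N) fps_const (la j) * sigma (F j)).
  rewrite rmorphB opprB addrA; congr (_ - _).
  rewrite rmorph_sum /=; under eq_bigr do rewrite rmorphM /= sigma_const.
  by rewrite subrK.
apply: ordgeB; first exact: subst_ordge.
by apply: ordge_le (hla _); rewrite -{1}[N]mul1n; nia.
Qed.

(** The conductor: when t is a quotient of two elements of the image of sigma,
    multiplying both by the numerator brings them into the image of the
    maximal ideal; their orders are then s and s + 1 with s > 0, and for
    d >= s^2 the order d = q s + r is that of a product of q factors. *)
Lemma subst_conductor : (exists G H, sigma H != 0 /\ sigma G = t * sigma H) ->
  exists c, forall y, ordge c y -> exists F, sigma F = y.
Proof.
move=> [A [C [C0 AC]]].
have [s' oC] := fps_order_ex C0.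
have oA : fps_order (sigma A) s'.+1.
  by rewrite AC -add1n; apply: fps_orderM oC; rewrite -[t]expr1; apply: fps_order_tX.
have A1 : mordge 1 A.
  move=> m; rewrite ltnS leqn0 mdeg_eq0 => /eqP ->; rewrite -subst_coef0.
  by case: oA => _ ->.
pose U := A * A; pose V := A * C; pose s := (s'.+1 + s')%N.
have U1 : mordge 1 U by apply: (@mordge_le _ _ 1 2) => //; apply: (mordgeM A1 A1).
have V1 : mordge 1 V by apply: (@mordgeM _ _ 1 0).
have oV : fps_order (sigma V) s by rewrite rmorphM; apply: fps_orderM.
have UV : sigma U = t * sigma V by rewrite !rmorphM /= {1}AC; ring.
have s0 : (0 < s)%N by [].
exists (s * s)%N.
pose q d := (d %/ s)%N; pose r d := (d %% s)%N.
pose F j := let d := (s * s + j)%N in V ^+ (q d - r d) * U ^+ r d.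
have rq j : (r (s * s + j) <= q (s * s + j))%N.
  have := ltn_pmod (s * s + j) s0.
  have : (s <= q (s * s + j))%N by rewrite leq_divRL // leq_addr.
  by rewrite /r; lia.
apply: (@subst_surj s _ F) => // j.
  apply: (@mordge_le _ _ _ ((q (s * s + j) - r (s * s + j)) + r (s * s + j)))%N.
    by rewrite subnK // leq_div2r // leq_addl.
  by apply: mordgeM; apply: mordgeX.
have -> : sigma (F j) = t ^+ r (s * s + j)%N * sigma V ^+ q (s * s + j)%N.
  rewrite rmorphM !rmorphXn /= UV exprMn mulrCA -exprD subnK //.
move: (s * s + j)%N => d.
rewrite [X in fps_order _ X](divn_eq d s) addnC -/(q d) -/(r d).
apply: fps_orderM; first exact: fps_order_tX.
elim: (q d) => [|e IH]; first by rewrite expr0 -(expr0 t); apply: fps_order_tX.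
by rewrite exprS mulSn; apply: fps_orderM.
Qed.

End Substitution.

(** * Derivations on a subring with a conductor *)

Section ConductorDerivation.
Variables (k : fieldType) (A : comNzRingType).
Local Notation B := (fps k).
Variables (sigma : {rmorphism A -> B}) (D : A -> B) (b : B).

(** If the image of sigma contains the ideal b k[[t]], then D extends to a
    derivation of k[[t]] with denominator b, namely
    y |-> (D (b y) - y D b) / b, and the derivations of k[[t]] over k are the
    multiples of d/dt. *)
Lemma conductor_derivation :
  b != 0 -> (forall y, exists x, sigma x = b * y) ->
  derivation_along sigma D -> (forall x, sigma x = 0 -> D x = 0) ->
  (forall c : k, exists2 x, sigma x = fps_const c & D x = 0) ->
  exists p, forall x, b * D x = p * fps_deriv (sigma x).
Proof.
move=> b0 surj der D0 Dconst.
pose lift y := sval (cid (surj y)).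
have liftE y : sigma (lift y) = b * y by rewrite /lift; case: cid.
have Dlift x y : sigma x = b * y -> D x = D (lift y).
  move=> xy; apply/eqP; rewrite -subr_eq0 -(derivation_alongB der); apply/eqP.
  by apply: D0; rewrite rmorphB /= xy liftE subrr.
pose u := lift 1; have uE : sigma u = b by rewrite liftE mulr1.
pose E y := D (lift y) - y * D u.
have derE : derivation_along id E.
  split=> [x y|x y]; rewrite /E.
    rewrite -(Dlift (lift x + lift y)) ?der.1; first by ring.
    by rewrite rmorphD /= !liftE mulrDr.
  have : D (u * lift (x * y)) = D (lift x * lift y).
    apply/eqP; rewrite -subr_eq0 -(derivation_alongB der); apply/eqP/D0.
    by rewrite rmorphB !rmorphM /= !liftE; ring.
  rewrite !der.2 uE !liftE => H; apply: (mulfI b0).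
  have -> : b * (D (lift (x * y)) - x * y * D u) =
     (b * D (lift (x * y)) + b * (x * y) * D u) - b * (x * y) * D u *+ 2 by ring.
  by rewrite H; ring.
have Ec (c : k) : E (fps_const c) = 0.
  have [x xc Dx] := Dconst c.
  rewrite /E -(Dlift (x * u)); last by rewrite rmorphM /= xc uE mulrC.
  by rewrite der.2 Dx mulr0 addr0 xc subrr.
exists (E (fps_t k)) => x; rewrite -(fps_derivation_eq derE Ec) /E.
rewrite -(Dlift (u * x)); last by rewrite rmorphM /= uE.
by rewrite der.2 uE addrK.
Qed.

End ConductorDerivation.

(** * Lengths as numbers of values *)

Lemma genmod_mem (R : comNzRingType) (V : lmodType R) (J : finType)
    (x : J -> V) j : x j \in genmod x.
Proof.
apply/asboolP; exists (fun i => (i == j)%:R).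
rewrite (bigD1 j) //= eqxx scale1r big1 ?addr0 // => i /negbTE ->.
by rewrite scale0r.
Qed.

Section QuotientModules.
Variables (R : comNzRingType) (V W : lmodType R) (U : submodClosed V).

Lemma quotmod_pi_eq u v : quotmod_pi U u = quotmod_pi U v <-> u - v \in U.
Proof.
rewrite -[u - v \in U]/(u - v \in submod_pred U) Quotient.idealrBE.
by split=> [/eqP|/eqP].
Qed.

Lemma quotmod_pi_linear : linear (quotmod_pi U).
Proof.
by move=> a u v; rewrite quotmod_piD -quotmod_scaleE.
Qed.

Lemma quotmod_pi0 : quotmod_pi U 0 = 0.
Proof. by apply: (addrI (quotmod_pi U 0)); rewrite -quotmod_piD !addr0. Qed.

Lemma quotmod_pi_eq0 v : quotmod_pi U v = 0 <-> v \in U.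
Proof. by rewrite -quotmod_pi0 quotmod_pi_eq subr0. Qed.

Lemma quotmod_lift (g : {linear V -> W}) : (forall v, v \in U -> g v = 0) ->
  exists phi : {linear quotmod U -> W}, forall v, phi (quotmod_pi U v) = g v.
Proof.
move=> g0.
pose rep (z : quotmod U) : V := sval (cid (quotmod_piK z)).
have repE z : quotmod_pi U (rep z) = z by rewrite /rep; case: cid.
pose phi z := g (rep z).
have phiE v : phi (quotmod_pi U v) = g v.
  apply/eqP; rewrite -subr_eq0 -linearB; apply/eqP/g0/quotmod_pi_eq.
  exact: repE.
have phi_lin : linear phi.
  move=> a x y; rewrite -(repE x) -(repE y) -quotmod_pi_linear !phiE.
  exact: linearP.
pose phiM := GRing.isLinear.Build _ _ _ _ phi phi_lin.
pose phiL : {linear quotmod U -> W} := HB.pack phi phiM.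
by exists phiL.
Qed.

End QuotientModules.

Definition count_below (P : pred nat) (N : nat) : nat := (\sum_(d < N) P d)%N.

Lemma count_below_sub (P Q : pred nat) N : (forall d, P d -> Q d) ->
  (count_below Q N - count_below P N = \sum_(d < N) (Q d && ~~ P d))%N.
Proof.
move=> PQ; rewrite -sumnB => [|d _]; last first.
  by case Pd: (P d) => //; rewrite lt0b; apply: PQ.
apply: eq_bigr => d _; case Pd: (P d); last by rewrite subn0 andbT.
by rewrite andbF; case: (Q d).
Qed.

Lemma count_below_mono (P Q : pred nat) N :
  (forall d, (d < N)%N -> P d -> Q d) -> (count_below P N <= count_below Q N)%N.
Proof.
by move=> PQ; apply: leq_sum => d _; case Pd: (P d) => //; rewrite PQ.
Qed.

Lemma count_below_eq (P Q : pred nat) N :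
  (forall d, P d -> Q d) -> (count_below Q N <= count_below P N)%N ->
  forall d, (d < N)%N -> Q d -> P d.
Proof.
move=> PQ le d dN Qd; apply/negP => /negP Pd; move: le; apply/negP.
rewrite -ltnNge /count_below [X in (_ < X)%N](bigD1 (Ordinal dN)) //= Qd.
rewrite [X in (X < _)%N](bigD1 (Ordinal dN)) //= (negbTE Pd) ltnS.
by apply: leq_sum => i _; case Pi: (P i) => //; rewrite PQ.
Qed.

Lemma count_below_shift (P : pred nat) a N : (forall d, (d < a)%N -> ~~ P d) ->
  count_below P (a + N) = count_below (fun d => P (a + d)%N) N.
Proof.
move=> Pa; rewrite /count_below big_split_ord /= big1 // => d _.
by rewrite (negbTE (Pa _ _)).
Qed.

Lemma count_below_le (P : pred nat) N : (count_below P N <= N)%N.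
Proof.
rewrite -[X in (_ <= X)%N]muln1 -[X in (_ <= X * _)%N]card_ord.
by rewrite -sum_nat_const; apply: leq_sum => d _; case: (P d).
Qed.

(** A chain with marked strict steps is thinned to a strict chain with as many
    steps as there are marks. *)
Lemma strict_subchain (R : comNzRingType) (M : lmodType R) (G : nat -> submodClosed M)
    (s : pred nat) :
  (forall i, {subset G i <= G i.+1}) ->
  (forall i, s i -> exists2 x, x \in G i.+1 & x \notin G i) ->
  forall N, exists c : nat -> submodClosed M,
    strict_chain (fun i => c i : {pred M}) (count_below s N) /\
    {subset c (count_below s N) <= G N}.
Proof.
move=> Gsub Gs; elim=> [|N [c [chain cN]]].
  by exists G; rewrite /count_below big_ord0; split.
rewrite /count_below big_ord_recr /= -/(count_below s N).
case sN: (s N); last first.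
  by rewrite addn0; exists c; split=> // x /cN /Gsub.
set L := count_below s N in chain cN *; rewrite addn1.
exists (fun i => if (i <= L)%N then c i else G N.+1); split; last first.
  by rewrite ltnn.
move=> i; rewrite ltnS => iL; case: (ltngtP i L) iL => // [iL|->] _.
  by rewrite /=; apply: chain.
split; first by move=> x /cN /Gsub.
have [x xG xN] := Gs N sN; exists x => //.
by apply: contra xN => /cN.
Qed.

Section Length.
Variables (k : fieldType) (R : comNzRingType).
Local Notation B := (fps k).
Variable iota : {rmorphism R -> B}.
Hypothesis iota_scalars : forall a : k, exists r, iota r = fps_const a.
Variables (V : lmodType R) (j : {linear V -> restr iota}).

Definition has_value (P : {pred V}) : pred nat :=
  fun d => `[< exists2 x, x \in P & fps_order (j x : B) d >].

Lemma value_mapD x y : (j (x + y) : B) = (j x : B) + (j y : B).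
Proof. exact: linearD. Qed.

Lemma value_mapB x y : (j (x - y) : B) = (j x : B) - (j y : B).
Proof. exact: linearB. Qed.

Lemma value_mapZ a x : (j (a *: x) : B) = iota a * (j x : B).
Proof. exact: (linearZ_LR j a x). Qed.

Lemma same_values_sub (P Q : submodClosed V) c :
  {subset P <= Q} -> (forall x, ordge c (j x : B) -> x \in P) ->
  (forall d, (d < c)%N -> has_value Q d -> has_value P d) ->
  {subset Q <= P}.
Proof.
move=> PQ Pc PV x xQ.
pose im (M : {pred V}) (y : B) := exists2 z, z \in M & (j z : B) = y.
have lin (M : submodClosed V) y z (a : k) :
    im M y -> im M z -> im M (y + fps_const a * z).
  move=> [u uM <-] [v vM <-]; have [r rE] := iota_scalars a.
  exists (u + r *: v); first by rewrite rpredD ?rpredZ.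
  by rewrite value_mapD value_mapZ rE.
have [||||y yP xy] :=
    @same_orders_sub k (im P) (im Q) c (lin P) (lin Q) _ _ _ (j x).
- by move=> y [z zP zy]; exists z => //; apply: PQ.
- by move=> y [z zQ <-] hz; exists z => //; apply: Pc.
- move=> d y dc [z zQ zy] yd.
  have /PV/asboolP : has_value Q d by apply/asboolP; exists z; rewrite ?zy.
  by case/(_ dc) => u uP ud; exists (j u : B) => //; exists u.
- by exists x.
rewrite -(subrK y x) rpredD // Pc // value_mapB xy subrr.
exact: ordge_zero.
Qed.

Lemma has_value_sub (P Q : {pred V}) : {subset P <= Q} ->
  forall d, has_value P d -> has_value Q d.
Proof.
by move=> PQ d /asboolP[x /PQ xQ xd]; apply/asboolP; exists x.
Qed.

Variable U : submodClosed V.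

Definition quotmod_preim (M : {pred quotmod U}) : {pred V} :=
  fun v => quotmod_pi U v \in M.

Fact quotmod_preim_submod (M : submodClosed (quotmod U)) :
  submod_closed (quotmod_preim M).
Proof.
split=> [|a u v hu hv]; rewrite unfold_in.
  by rewrite quotmod_pi0 rpred0.
by rewrite quotmod_pi_linear rpredD ?rpredZ.
Qed.
HB.instance Definition _ (M : submodClosed (quotmod U)) :=
  GRing.isSubmodClosed.Build R V (quotmod_preim M) (quotmod_preim_submod M).

Definition order_filtration (N : nat) : {pred quotmod U} :=
  fun z => `[< exists2 x, z = quotmod_pi U x & ordge N (j x : B) >].

Fact order_filtration_submod N : submod_closed (order_filtration N).
Proof.
split=> [|a u v /asboolP[x -> hx] /asboolP[y -> hy]]; apply/asboolP.
  exists 0; last by rewrite linear0; apply: ordge_zero.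
  by rewrite quotmod_pi0.
exists (a *: x + y); first by rewrite quotmod_pi_linear.
rewrite value_mapD value_mapZ; apply: ordgeD => //.
by rewrite -[N]add0n; apply: ordgeM.
Qed.
HB.instance Definition _ N :=
  GRing.isSubmodClosed.Build R (quotmod U) (order_filtration N)
    (order_filtration_submod N).

(** The length of V / U is the number of values of V that are not values of
    U: a strict chain between U and V gains a value at each step, and the
    filtration of V by the order jumps exactly at those values. *)
Lemma has_length_count c : (forall x, ordge c (j x : B) -> x \in U) ->
  has_length (quotmod U)
    (count_below (has_value predT) c - count_below (has_value U) c).
Proof.
move=> Uc; have UT : forall d, has_value U d -> has_value predT d.
  exact: has_value_sub.
split.
  rewrite count_below_sub //.
  pose gap d := has_value predT d && ~~ has_value U d.
  pose G i : submodClosed (quotmod U) := order_filtration (c - i).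
  pose s i := (i < c)%N && gap (c - i.+1)%N.
  have Gsub i : {subset G i <= G i.+1}.
    move=> z /asboolP[x -> hx]; apply/asboolP; exists x => //.
    by apply: ordge_le hx; lia.
  have Gs i : s i -> exists2 x, x \in G i.+1 & x \notin G i.
    move=> /andP[ic /andP[/asboolP[x _ xd] nU]].
    exists (quotmod_pi U x); first by apply/asboolP; exists x => //; case: xd.
    apply: contra nU => /asboolP[y /quotmod_pi_eq xyU hy].
    apply/asboolP; exists (x - y) => //; rewrite value_mapB -[- _]mulN1r.
    apply: order_addge => //; rewrite -[_.+1]add0n; apply: ordgeM => //.
    by have -> : (c - i.+1).+1 = (c - i)%N by lia.
  have [ch [chain _]] := strict_subchain Gsub Gs c.
  exists ch; suff <- : count_below s c = (\sum_(d < c) gap d)%N by [].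
  rewrite /count_below (reindex_inj rev_ord_inj); apply: eq_bigr => i _ /=.
  rewrite /s; have -> : (c - (c - i.+1).+1 = i)%N by have := ltn_ord i; lia.
  by have -> : (c - i.+1 < c)%N by have := ltn_ord i; lia.
move=> ch l' chain.
pose P i : submodClosed V := quotmod_preim (ch i).
have UP i : {subset U <= P i}.
  move=> x xU; rewrite unfold_in.
  by have/quotmod_pi_eq0 -> := xU; rewrite rpred0.
have step i : (i < l')%N ->
    (count_below (has_value (P i)) c < count_below (has_value (P i.+1)) c)%N.
  move=> il; have [sub [z zS zN]] := chain i il.
  have PP : {subset P i <= P i.+1} by move=> x; apply: sub.
  rewrite ltnNge; apply/negP => le; move: zN.
  have [x zx] := quotmod_piK z; rewrite zx in zS *.
  apply/negP/negPn; apply: (@same_values_sub (P i) (P i.+1) c) => //.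
    by move=> y hy; apply: UP; apply: Uc.
  by move=> d dc; apply: (count_below_eq _ le) => //; apply: has_value_sub.
have : (l' + count_below (has_value (P 0%N)) c <= count_below (has_value (P l')) c)%N.
  elim: l' {chain} step => [//|l IH] step.
  by rewrite addSn; apply: leq_ltn_trans (IH _) (step _ _) => // i il; apply: step; lia.
have := @count_below_mono (has_value U) (has_value (P 0%N)) c
  (fun d _ => has_value_sub (@UP 0%N) (d := d)).
have := @count_below_mono (has_value (P l')) (has_value predT) c
  (fun d _ => @has_value_sub _ predT (fun _ _ => isT) d).
lia.
Qed.

End Length.

(** * The module of differentials of a branch *)

Lemma order_mulK (k : fieldType) (p y : fps k) q d :
  fps_order p q -> fps_order (p * y) (q + d) -> fps_order y d.
Proof.
move=> pq py; have y0 : y != 0.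
  by apply: contraTneq (fps_order_neq0 py) => ->; rewrite mulr0 eqxx.
have [e ye] := fps_order_ex y0.
have := fps_order_uniq (fps_orderM pq ye) py.
by move/addnI => <-.
Qed.

Lemma order_mul_ge (k : fieldType) (p y : fps k) q d :
  ordge q p -> fps_order (p * y) d -> (q <= d)%N.
Proof.
by move=> pq; apply: ordge_order; rewrite -[q]addn0; apply: ordgeM.
Qed.

Section Branch.
Variables (k : fieldType) (n m : nat) (f : 'I_m -> mfps n k).
Hypothesis k_char0 : [pchar k] =i pred0.
Variables (R : idomainType) (pi : {rmorphism mfps n k -> R}).
Hypothesis pi_surj : forall r : R, exists F : mfps n k, pi F = r.
Hypothesis pi_ker : forall F : mfps n k, pi F = 0 <-> F \in gen_ideal f.
Variable iota : {rmorphism R -> fps k}.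
Hypothesis iota_inj : injective iota.
Hypothesis iota_const :
  forall c : k, iota (pi (mfps_const n c)) = fps_const c.
Hypothesis frac_R : forall z : laurent k, exists a b : R,
  b != 0 /\ z = tofrac (iota a) / tofrac (iota b).

Local Notation B := (fps k).
Local Notation t := (fps_t k).
Let sigma : {rmorphism mfps n k -> B} := iota \o pi.
Local Notation x' i := (fps_deriv (param pi iota i)).
Local Notation D := (derivmod pi iota).

Let iota_eq0 r : (iota r == 0) = (r == 0).
Proof. by rewrite -(rmorph0 iota) (inj_eq iota_inj). Qed.

Lemma iota_scalars (a : k) : exists r, iota r = fps_const a.
Proof. by exists (pi (mfps_const n a)). Qed.

Lemma branch_conductor : exists c, forall y, ordge c y -> exists r, iota r = y.
Proof.
have [|c hc] := @subst_conductor n k k_char0 sigma iota_const.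
  have [a [b [b0 tab]]] := frac_R (tofrac t).
  have [[F Fa] [G Gb]] := (pi_surj a, pi_surj b).
  exists F, G; rewrite /sigma /= Fa Gb iota_eq0; split=> //.
  apply/eqP; rewrite -tofrac_eq rmorphM /= tab divfK //.
  by rewrite tofrac_eq0 iota_eq0.
by exists c => y /hc [F <-]; exists (pi F).
Qed.

Lemma relation_subst0 j : iota (pi (f j)) = 0.
Proof.
have -> : pi (f j) = 0 by apply/pi_ker; exact: (@genmod_mem _ (mfps n k)^o).
exact: rmorph0.
Qed.

Lemma derivmodP (y : B) : (y : restr iota) \in D <->
  exists a : 'I_n -> R, y = \sum_i iota (a i) * x' i.
Proof. by split=> [/asboolP|h]; last by apply/asboolP. Qed.

Lemma common_denominator (J : finType) (z : J -> laurent k) :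
  exists (b : R) (a : J -> R),
    b != 0 /\ forall j, tofrac (iota b) * z j = tofrac (iota (a j)).
Proof.
have h j := cid (frac_R (z j)).
pose num j := sval (h j).
have h' j : exists b, b != 0 /\ z j = tofrac (iota (num j)) / tofrac (iota b).
  exact: (svalP (h j)).
pose den j := sval (cid (h' j)).
have dE j : den j != 0 /\ z j = tofrac (iota (num j)) / tofrac (iota (den j)).
  exact: (svalP (cid (h' j))).
exists (\prod_j den j), (fun j => num j * \prod_(i | i != j) den i); split.
  by apply/prodf_neq0 => j _; case: (dE j).
move=> j; have [d0 ->] := dE j.
rewrite (bigD1 j) //= !rmorphM /= mulrC -!mulrA mulKf 1?mulrC //.
by rewrite tofrac_eq0 iota_eq0.
Qed.

Section Conductor.
Variable c : nat.
Hypothesis conductor : forall y, ordge c y -> exists r, iota r = y.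

Lemma deriv_in_derivmod r : (fps_deriv (iota r) : restr iota) \in D.
Proof.
have [F <-] := pi_surj r; apply/derivmodP.
exists (fun i => pi (mfps_deriv i F)).
exact: (subst_chain_rule k_char0 (sigma := sigma) iota_const F).
Qed.

(** In characteristic 0 a series of order >= c has a primitive of order > c,
    which lies in R. *)
Lemma ordge_in_derivmod y : ordge c y -> (y : restr iota) \in D.
Proof.
move=> /(fps_primitive k_char0) [z hz <-].
have [|r <-] := conductor (y := z); first by apply: ordge_le hz.
exact: deriv_in_derivmod.
Qed.

(** Otherwise D would be zero, although it contains t^c. *)
Lemma param_deriv_neq0 : exists i, x' i != 0.
Proof.
apply: contrapT => h.
have /derivmodP [a ta] := ordge_in_derivmod (@ordge_tX k c).
have := fps_order_neq0 (fps_order_tX k c); rewrite ta big1 ?eqxx // => i _.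
case: (eqVneq (x' i) 0) => [->|nz]; first by rewrite mulr0.
by case: h; exists i.
Qed.

(** A vector u orthogonal to the relations defines the k-derivation of R that
    maps r = pi F to sum_i u_i d_i F; being a multiple of d/dt over the
    fraction field, it takes proportional values at the X_i and the x_i'. *)
Lemma orthogonal_proportional (u : 'I_n -> R) :
  (forall j, \sum_i u i * pi (mfps_deriv i (f j)) = 0) ->
  exists p, forall i, t ^+ c * iota (u i) = p * x' i.
Proof.
move=> hu.
pose E F := \sum_i iota (u i) * sigma (mfps_deriv i F).
have derE : derivation_along sigma E.
  split=> F G; rewrite /E.
    rewrite -big_split; apply: eq_bigr => i _ /=.
    by rewrite mfps_derivD !rmorphD mulrDr.
  rewrite !mulr_sumr -big_split; apply: eq_bigr => i _ /=.
  by rewrite mfps_derivM !rmorphD !rmorphM /=; ring.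
have Ef j : E (f j) = 0.
  rewrite -(rmorph0 iota) -(hu j) rmorph_sum; apply: eq_bigr => i _.
  by rewrite rmorphM.
have f0 j : sigma (f j) = 0 := relation_subst0 j.
have [|||||p hp] := @conductor_derivation k _ sigma E (t ^+ c).
- exact: fps_order_neq0 (fps_order_tX k c).
- move=> y; have [|r <-] := conductor (y := t ^+ c * y).
    by rewrite -[c in ordge c]addn0; apply: ordgeM => //; apply: ordge_tX.
  by have [F <-] := pi_surj r; exists F.
- by [].
- move=> F /eqP; rewrite /sigma /= iota_eq0 => /eqP /pi_ker /asboolP [a ->].
  rewrite (derivation_along_sum derE) big1 // => j _.
  by rewrite derE.2 Ef f0 mulr0 mul0r addr0.
- move=> a; exists (mfps_const n a); first exact: iota_const.
  by rewrite /E big1 // => i _; rewrite mfps_derivC rmorph0 mulr0.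
exists p => i; rewrite -hp; congr (_ * _); rewrite /E (bigD1 i) //= big1.
  by rewrite mfps_deriv_X eqxx rmorph1 rmorph1 mulr1 addr0.
move=> j /negbTE ji; rewrite mfps_deriv_X ji.
by rewrite /= !rmorph0 mulr0.
Qed.

(** The conductor bounds the denominators of D^-1: its elements are the p / t^c
    for the p that clear D. *)
Definition clears (p : B) : Prop :=
  forall y, (y : restr iota) \in D -> exists r, p * y = t ^+ c * iota r.

Local Notation Om := (Omega pi f).
Local Notation proj v := (quotmod_pi (genmod (diff_row pi f)) v).

Lemma chain_rule_relation j :
  \sum_i iota (pi (mfps_deriv i (f j))) * x' i = 0.
Proof.
have f0 : sigma (f j) = 0 := relation_subst0 j.
have := subst_chain_rule k_char0 (sigma := sigma) iota_const (f j).
rewrite f0 => <-; by apply: fpsP => i; rewrite /= !if_same mul0rn.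
Qed.

(** Each homomorphism Omega -> R is alpha delta with alpha = p / t^c, where
    delta : Omega -> D sends dX_i to x_i'. *)
Lemma hom_scaled_delta (phi : {linear Om -> R^o}) :
  exists p, forall v : 'rV[R]_n,
    t ^+ c * iota (phi (proj v)) = p * \sum_i iota (v 0 i) * x' i.
Proof.
pose u i : R := phi (proj (delta_mx 0 i)).
have phiE v : phi (proj v) = \sum_i v 0 i * u i.
  pose g v := phi (proj v).
  have g_lin : linear g.
    by move=> a y z; rewrite /g quotmod_pi_linear linearP.
  pose gM := GRing.isLinear.Build _ _ _ _ g g_lin.
  pose gL : {linear 'rV[R]_n -> R^o} := HB.pack g gM.
  rewrite {1}(row_sum_delta v) -[LHS]/(gL _) linear_sum.
  by apply: eq_bigr => i _; exact: (linearZ_LR gL).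
have hu j : \sum_i u i * pi (mfps_deriv i (f j)) = 0.
  transitivity (phi (proj (diff_row pi f j)) : R).
    by rewrite phiE; apply: eq_bigr => i _; rewrite mxE mulrC.
  have -> : proj (diff_row pi f j) = 0; last exact: linear0.
  by apply/quotmod_pi_eq0; exact: genmod_mem.
have [p hp] := orthogonal_proportional hu; exists p => v.
rewrite phiE rmorph_sum !mulr_sumr; apply: eq_bigr => i _ /=.
by rewrite rmorphM mulrCA hp mulrCA.
Qed.

Lemma clears_hom p : clears p -> exists phi : {linear Om -> R^o},
  forall v : 'rV[R]_n,
    t ^+ c * iota (phi (proj v)) = p * \sum_i iota (v 0 i) * x' i.
Proof.
move=> hp.
have hu i : exists r, p * x' i = t ^+ c * iota r.
  exact/hp/(@genmod_mem _ (restr iota)).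
pose u i := sval (cid (hu i)).
have uE i : p * x' i = t ^+ c * iota (u i) by exact: (svalP (cid (hu i))).
pose g (v : 'rV[R]_n) : R^o := \sum_i v 0 i * u i.
have g_lin : linear g.
  move=> a y z; rewrite /g scaler_sumr -big_split; apply: eq_bigr => i _.
  by rewrite !mxE mulrDl -mulrA.
pose gM := GRing.isLinear.Build _ _ _ _ g g_lin.
pose gL : {linear 'rV[R]_n -> R^o} := HB.pack g gM.
have gE v : t ^+ c * iota (g v) = p * \sum_i iota (v 0 i) * x' i.
  rewrite rmorph_sum !mulr_sumr; apply: eq_bigr => i _ /=.
  by rewrite rmorphM mulrCA -uE mulrCA.
have g0 v : v \in genmod (diff_row pi f) -> gL v = 0.
  case/asboolP=> a ->; rewrite linear_sum big1 // => j _; rewrite linearZ.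
  have -> : gL (diff_row pi f j) = 0; last exact: scaler0.
  apply: iota_inj; rewrite rmorph0.
  apply: (mulfI (fps_order_neq0 (fps_order_tX k c))).
  rewrite (gE (diff_row pi f j)) mulr0.
  rewrite [X in p * X](_ : _ = 0) ?mulr0 // -[RHS](chain_rule_relation j).
  by apply: eq_bigr => i _; rewrite mxE.
have [phi hphi] := @quotmod_lift R _ _ (genmod (diff_row pi f)) gL g0.
by exists phi => v; rewrite hphi gE.
Qed.

(** A vector orthogonal to the relations is proportional to (x_1', ..., x_n'),
    hence orthogonal to v; over the fraction field this puts v in the span of
    the relations. *)
Lemma delta_kernel_torsion (v : 'rV[R]_n) :
  \sum_i iota (v 0 i) * x' i = 0 -> torsion (proj v).
Proof.
move=> v0.
pose toK (r : R) : laurent k := tofrac (iota r).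
have toK_inj : injective toK by move=> a b /eqP; rewrite tofrac_eq => /eqP /iota_inj.
pose M : 'M[laurent k]_(m, n) := \matrix_(j, i) toK (pi (mfps_deriv i (f j))).
pose w : 'rV[laurent k]_n := \row_i toK (v 0 i).
(* Either w is a combination of the relations over the fraction field, or some
   column of the cokernel matrix of M separates it from them. *)
have [/submxP [a wE]|] := boolP (w <= M)%MS.
  have [b [a' [b0 ba]]] := common_denominator (fun j => a 0 j).
  exists b => //; rewrite [LHS]quotmod_scaleE.
  apply/quotmod_pi_eq0/asboolP; exists a'.
  apply/rowP => i; rewrite mxE summxE; apply: toK_inj.
  rewrite /toK rmorphM rmorph_sum rmorphM rmorph_sum /=.
  have := congr1 (fun z : 'rV__ => z 0 i) wE; rewrite !mxE /toK => ->.
  rewrite mulr_sumr; apply: eq_bigr => j _.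
  by rewrite mulrA ba !mxE /toK !rmorphM.
rewrite submxE => /eqP wM; exfalso.
have [l wl] : exists l, (w *m cokermx M) 0 l != 0.
  apply: contrapT => h; apply: wM; apply/rowP => l; rewrite [RHS]mxE.
  by apply/eqP; apply: contrapT => /negP hl; apply: h; exists l.
have [b [u [b0 bu]]] := common_denominator (fun i => cokermx M i l).
have hu j : \sum_i u i * pi (mfps_deriv i (f j)) = 0.
  apply: toK_inj; rewrite /toK !rmorph_sum rmorph0 rmorph0 /=.
  transitivity (toK b * (M *m cokermx M) j l).
    rewrite mxE mulr_sumr; apply: eq_bigr => i _.
    by rewrite !rmorphM /= -bu [M j i]mxE /toK; ring.
  by rewrite mulmx_coker mxE mulr0.
have [p hp] := orthogonal_proportional hu.
have vu : \sum_i iota (v 0 i) * iota (u i) = 0.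
  apply: (mulfI (fps_order_neq0 (fps_order_tX k c))).
  transitivity (p * \sum_i iota (v 0 i) * x' i); last by rewrite v0 !mulr0.
  by rewrite !mulr_sumr; apply: eq_bigr => i _; rewrite mulrCA hp mulrCA.
move: wl; apply/negP; rewrite negbK.
have : toK b * (w *m cokermx M) 0 l = tofrac (\sum_i iota (v 0 i) * iota (u i)).
  rewrite mxE mulr_sumr rmorph_sum; apply: eq_bigr => i _.
  by rewrite rmorphM /= -bu [w 0 i]mxE /toK; ring.
rewrite vu tofrac0 => /eqP.
by rewrite mulf_eq0 tofrac_eq0 iota_eq0 (negbTE b0).
Qed.

(** * Values of R, of D and of the images of Omega *)

Local Notation valR := (has_value (restr_incl iota) predT).
Local Notation valD := (has_value (idfun : restr iota -> restr iota) D).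

Lemma count_below_predT N : count_below
  (has_value (idfun : restr iota -> restr iota) predT) N = N.
Proof.
rewrite /count_below (eq_bigr (fun=> 1%N)) ?sum1_card ?card_ord // => d _.
suff -> : has_value (idfun : restr iota -> restr iota) predT d by [].
by apply/asboolP; exists (t ^+ d) => //; apply: fps_order_tX.
Qed.

(** The count may stop at any N >= c: the formula for the length of
    R / phi(Omega) compares R and D at two different bounds. *)
Lemma length_derivmod N : (c <= N)%N ->
  has_length (quotmod D) (N - count_below valD N).
Proof.
move=> cN; rewrite -{1}[N]count_below_predT.
apply: (@has_length_count _ _ iota iota_scalars _
  (idfun : {linear restr iota -> restr iota}) D).
by move=> y hy; apply: ordge_in_derivmod; apply: ordge_le hy.
Qed.

Lemma length_closure N : (c <= N)%N ->
  has_length (quotmod (image_mod (restr_incl iota))) (N - count_below valR N).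
Proof.
move=> cN.
have -> : count_below valR N = count_below
    (has_value (idfun : restr iota -> restr iota) (image_mod (restr_incl iota))) N.
  apply: eq_bigr => d _; congr nat_of_bool; apply/asboolP/asboolP.
    by move=> [r _ rd]; exists (iota r) => //; apply/asboolP; exists r.
  by move=> [y /asboolP[r ->] rd]; exists r.
rewrite -{1}[N]count_below_predT.
apply: (@has_length_count _ _ iota iota_scalars _
  (idfun : {linear restr iota -> restr iota}) (image_mod (restr_incl iota))).
move=> y hy; have [|r <-] := conductor (y := y); first exact: ordge_le hy.
by apply/asboolP; exists r.
Qed.

(** phi = (p / t^c) delta. *)
Definition scales_delta (phi : {linear Om -> R^o}) (p : B) : Prop :=
  forall v : 'rV[R]_n,
    t ^+ c * iota (phi (proj v)) = p * \sum_i iota (v 0 i) * x' i.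

Lemma scales_delta_clears phi p : scales_delta phi p -> clears p.
Proof.
move=> hp y /derivmodP [a ->]; exists (phi (proj (\row_i a i))).
by rewrite hp; congr (_ * _); apply: eq_bigr => i _; rewrite mxE.
Qed.

Lemma scales_delta_image phi p : scales_delta phi p -> forall r : R,
  (r : R^o) \in image_mod phi <->
  exists2 y, (y : restr iota) \in D & t ^+ c * iota r = p * y.
Proof.
move=> hp r; split=> [/asboolP[w ->]|[y /derivmodP[a ->] hr]].
  have [v ->] := quotmod_piK w; rewrite hp; eexists; last by [].
  by apply/derivmodP; exists (fun i => v 0 i).
apply/asboolP; exists (proj (\row_i a i)); apply: iota_inj.
apply: (mulfI (fps_order_neq0 (fps_order_tX k c))).
by rewrite hr hp; congr (_ * _); apply: eq_bigr => i _; rewrite mxE.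
Qed.

(** J = phi(Omega) is (p / t^c) D, so its values are those of D translated by
    q - c. *)
Lemma count_below_image phi p q : scales_delta phi p -> fps_order p q ->
  count_below (has_value (restr_incl iota) (image_mod phi)) (q + c) =
  count_below valD (c + c).
Proof.
move=> hp pq.
(* W is the set of values of p D = t^c J, which are all at least c and at least
   q; it is counted from c to compare with J, and from q to compare with D. *)
pose W d := `[< exists2 y, (y : restr iota) \in D & fps_order (p * y) d >].
transitivity (count_below W (c + (q + c))).
  rewrite (@count_below_shift W) => [|d dc].
    apply: eq_bigr => d _; congr nat_of_bool; apply/asboolP/asboolP.
      move=> [r /(scales_delta_image hp)[y yD yr] rd]; exists y => //.
      by rewrite -yr; apply: fps_orderM => //; apply: fps_order_tX.
    move=> [y yD yd]; have [r hr] := scales_delta_clears hp yD.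
    exists r; first by apply/(scales_delta_image hp); exists y.
    by apply: order_mulK (fps_order_tX k c) _; rewrite -hr.
  apply/asboolPn => -[y yD]; have [r ->] := scales_delta_clears hp yD.
  move/(order_mul_ge (@ordge_tX k c)); lia.
rewrite addnCA (@count_below_shift W) => [|d dq].
  apply: eq_bigr => d _; congr nat_of_bool; apply/asboolP/asboolP.
    by move=> [y yD yd]; exists y => //; apply: order_mulK pq yd.
  by move=> [y yD yd]; exists y => //; apply: fps_orderM.
by apply/asboolPn => -[y yD] /(order_mul_ge (order_ordge pq)); lia.
Qed.

Lemma length_image phi p q lD lR :
  scales_delta phi p -> fps_order p q ->
  has_length (quotmod D) lD ->
  has_length (quotmod (image_mod (restr_incl iota))) lR ->
  exists2 l, has_length (quotmod (image_mod phi)) l &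
    l%:Z = lD%:Z - lR%:Z + (q%:Z - c%:Z).
Proof.
move=> hp pq hD hR.
(* The bounds q + c for R and c + c for D correspond to each other under the
   shift by q - c. An element r of R of order at least q + c lies in
   J = (p / t^c) D since t^c r / p has order at least c + c, hence is in D. *)
have := has_length_uniq hD (length_derivmod (leq_addl c c)).
have := has_length_uniq hR (length_closure (leq_addl q c)).
have : (count_below valD (c + c) <= count_below valR (q + c))%N.
  rewrite -(count_below_image hp pq); apply: count_below_mono => d _.
  exact: has_value_sub.
have := count_below_le valR (q + c); have := count_below_le valD (c + c).
move=> leD leR le lRE lDE.
exists (count_below valR (q + c) - count_below valD (c + c))%N; last by lia.
rewrite -(count_below_image hp pq).
apply: (@has_length_count _ _ iota iota_scalars _ (restr_incl iota)
  (image_mod phi)) => r hr.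
apply/(scales_delta_image hp).
have [|y hy yr] := @fps_divide k p (t ^+ c * iota r) q (c + c) pq.
  by rewrite addnCA; apply: ordgeM => //; apply: ordge_tX.
by exists y => //; apply: ordge_in_derivmod; apply: ordge_le hy; apply: leq_addr.
Qed.

(** The powers t^d with d >= c give arbitrarily long strict chains in R. *)
Lemma zero_image_length phi l : scales_delta phi 0 ->
  ~ has_length (quotmod (image_mod phi)) l.
Proof.
move=> hp [_ max].
pose G i : submodClosed (quotmod (image_mod phi)) :=
  order_filtration (restr_incl iota) (U := image_mod phi) (c + (l.+1 - i)).
suff chain : strict_chain (fun i => G i : {pred _}) l.+1.
  by have := max _ _ chain; rewrite ltnn.
move=> i il; split.
  by move=> z /asboolP[x -> hx]; apply/asboolP; exists x => //; apply: ordge_le hx; lia.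
pose e := (c + (l.+1 - i.+1))%N.
have [|r rE] := conductor (y := t ^+ e).
  by apply: ordge_le (@ordge_tX k e); apply: leq_addr.
exists (quotmod_pi (image_mod phi) (r : R^o)).
  by apply/asboolP; exists r => //; rewrite /restr_incl rE; apply: ordge_tX.
apply/asboolPn => -[y /quotmod_pi_eq/(scales_delta_image hp)[z _ yz] hy].
have ry : iota r = iota y.
  move: yz; rewrite mul0r => /eqP; rewrite mulf_eq0.
  rewrite (negbTE (fps_order_neq0 (fps_order_tX k c))) /= rmorphB subr_eq0.
  by move/eqP.
have := ordge_order hy; rewrite /restr_incl -ry rE => /(_ _ (fps_order_tX k e)).
by rewrite /e; lia.
Qed.

(** Differentiation maps R into D and lowers the positive values by one. *)
Lemma valR_deriv d : valR d.+1 -> valD d.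
Proof.
move/asboolP=> [r _ rd]; apply/asboolP; exists (fps_deriv (iota r)).
  exact: deriv_in_derivmod.
exact: order_deriv.
Qed.

Lemma valR0 : valR 0%N.
Proof.
apply/asboolP; exists 1 => //; rewrite /restr_incl rmorph1.
by split=> //=; rewrite oner_eq0.
Qed.

Lemma count_below_valR N :
  count_below valR N.+1 = (count_below (fun d => valR d.+1) N).+1.
Proof. by rewrite /count_below big_ord_recl valR0. Qed.

Lemma length_derivmod_le lD lR :
  has_length (quotmod D) lD ->
  has_length (quotmod (image_mod (restr_incl iota))) lR -> (lD <= lR)%N.
Proof.
move=> /has_length_uniq/(_ (length_derivmod (leqnn c))) ->.
move=> /has_length_uniq/(_ (length_closure (leqnSn c))) ->.
rewrite count_below_valR; have := count_below_le valD c.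
have := @count_below_mono (fun d => valR d.+1) valD c (fun d _ => @valR_deriv d).
by lia.
Qed.

(** When the two lengths agree, every value of D is a value of the space of
    derivatives of elements of R, and the two coincide. *)
Lemma derivmod_exact l :
  has_length (quotmod D) l ->
  has_length (quotmod (image_mod (restr_incl iota))) l ->
  forall y, (y : restr iota) \in D -> exists r, fps_deriv (iota r) = y.
Proof.
move=> /has_length_uniq/(_ (length_derivmod (leqnn c))) lD.
move=> /has_length_uniq/(_ (length_closure (leqnSn c))); rewrite lD.
rewrite count_below_valR => lR.
have le : (count_below valD c <= count_below (fun d => valR d.+1) c)%N.
  have := count_below_le valD c.
  have := count_below_le (fun d => valR d.+1) c; lia.
have valD_deriv := count_below_eq (@valR_deriv) le.
apply: (@same_orders_sub k (fun y => exists r, fps_deriv (iota r) = y)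
  (fun y => (y : restr iota) \in D) c).
- move=> _ _ a [r <-] [s <-]; have [e he] := iota_scalars a.
  exists (r + e * s); rewrite rmorphD rmorphM he fps_derivD fps_derivM.
  by rewrite fps_derivC mulr0 addr0.
- move=> y z a yD zD; have [e <-] := iota_scalars a.
  by apply: (rpredD yD); apply: (@rpredZ _ (restr iota) D e z).
- by move=> _ [r <-]; exact: deriv_in_derivmod.
- move=> y _ /(fps_primitive k_char0) [z hz <-].
  have [|r <-] := conductor (y := z); first by apply: ordge_le hz.
  by exists r.
move=> d y dc yD yd.
have /(valD_deriv _ dc)/asboolP[r _ rd] : valD d by apply/asboolP; exists y.
exists (fps_deriv (iota r)); first by exists r.
exact: order_deriv.
Qed.

(** * The inverse of D *)

Lemma clears_derivmod_inv p q : clears p -> fps_order p q ->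
  derivmod_inv pi iota (tofrac p / tofrac (t ^+ c)) /\
  has_val (tofrac p / tofrac (t ^+ c)) (q%:Z - c%:Z).
Proof.
move=> hp pq.
have tc : tofrac (t ^+ c) != 0 :> laurent k.
  by rewrite tofrac_eq0 (fps_order_neq0 (fps_order_tX k c)).
split; last by exists c, p, q; rewrite divfK.
move=> y /hp [r pr]; exists r; apply: (mulIf tc).
by rewrite mulrAC divfK // -!rmorphM /= pr mulrC.
Qed.

(** An element alpha of D^-1 with v(alpha) finite is p / t^c, for the p
    attached to the vector (alpha x_1', ..., alpha x_n') of R^n, which is
    orthogonal to all the relations. *)
Lemma derivmod_inv_clears alpha d : derivmod_inv pi iota alpha ->
  has_val alpha d ->
  exists p q, [/\ clears p, fps_order p q & d = q%:Z - c%:Z].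
Proof.
move=> inv val.
have hu i : exists r, alpha * tofrac (x' i) = tofrac (iota r).
  by apply: inv; apply: (@genmod_mem _ (restr iota)).
pose u i := sval (cid (hu i)).
have uE i : alpha * tofrac (x' i) = tofrac (iota (u i)) by exact: (svalP (cid (hu i))).
have rel j : \sum_i u i * pi (mfps_deriv i (f j)) = 0.
  apply/eqP; rewrite -iota_eq0 -tofrac_eq0 !rmorph_sum /=.
  transitivity (alpha * tofrac (\sum_i iota (pi (mfps_deriv i (f j))) * x' i) == 0).
    congr (_ == 0); rewrite rmorph_sum mulr_sumr; apply: eq_bigr => i _.
    by rewrite !rmorphM /= -uE; ring.
  by rewrite chain_rule_relation tofrac0 mulr0 eqxx.
have [p hp] := orthogonal_proportional rel.
have alpha_t : alpha * tofrac (t ^+ c) = tofrac p.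
  have [i xi] := param_deriv_neq0.
  have xi0 : tofrac (x' i) != 0 :> laurent k by rewrite tofrac_eq0.
  by apply: (mulIf xi0); rewrite mulrAC uE -!rmorphM /= -hp mulrC.
have p0 : p != 0.
  have [e [g [j [ag gj _]]]] := val.
  apply: contraTneq (fps_order_neq0 gj) => p0; rewrite negbK.
  have : alpha == 0.
    move: alpha_t; rewrite p0 tofrac0 => /eqP; rewrite mulf_eq0 tofrac_eq0.
    by rewrite (negbTE (fps_order_neq0 (fps_order_tX k c))) orbF.
  by move=> /eqP a0; rewrite -tofrac_eq0 -ag a0 mul0r.
have [q pq] := fps_order_ex p0; exists p, q; split=> //.
  move=> y /derivmodP [a ->]; exists (\sum_i a i * u i).
  rewrite rmorph_sum !mulr_sumr; apply: eq_bigr => i _ /=.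
  by rewrite rmorphM mulrCA -hp mulrCA.
by apply: (has_val_uniq val); exists c, p, q.
Qed.

(** D is contained in k[[t]] and t^c k[[t]] in R. *)
Lemma clears_tX : clears (t ^+ c * t ^+ c).
Proof.
move=> y _; have [|r rE] := conductor (y := t ^+ c * y).
  by rewrite -[c in ordge c]addn0; apply: ordgeM => //; apply: ordge_tX.
by exists r; rewrite rE mulrA.
Qed.

(** The least order of a p that clears D, which yields both v(D^-1) and, by the
    length formula, the least length of a quotient R / phi(Omega). *)
Lemma clears_min : exists q,
  (exists2 p, clears p & fps_order p q) /\
  (forall p q', clears p -> fps_order p q' -> (q <= q')%N).
Proof.
have ex : exists q, `[< exists2 p, clears p & fps_order p q >].
  exists (c + c)%N; apply/asboolP; exists (t ^+ c * t ^+ c).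
    exact: clears_tX.
  by apply: fps_orderM; apply: fps_order_tX.
case: (ex_minnP ex) => q /asboolP hq qmin; exists q; split=> // p q' hp pq'.
by apply: qmin; apply/asboolP; exists p.
Qed.

Lemma min_val_derivmod_inv q :
  (exists2 p, clears p & fps_order p q) ->
  (forall p q', clears p -> fps_order p q' -> (q <= q')%N) ->
  min_val (derivmod_inv pi iota) (q%:Z - c%:Z).
Proof.
move=> [p hp pq] qmin; have [inv val] := clears_derivmod_inv hp pq.
split; first by exists (tofrac p / tofrac (t ^+ c)).
move=> z d inv_z val_z; have [p' [q' [hp' pq' ->]]] := derivmod_inv_clears inv_z val_z.
by have := qmin _ _ hp' pq'; lia.
Qed.

Lemma h_inv_Omega q lD lR :
  (exists2 p, clears p & fps_order p q) ->
  (forall p q', clears p -> fps_order p q' -> (q <= q')%N) ->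
  has_length (quotmod D) lD ->
  has_length (quotmod (image_mod (restr_incl iota))) lR ->
  exists2 h, h_inv Om h & h%:Z = lD%:Z - lR%:Z + (q%:Z - c%:Z).
Proof.
move=> [p hp pq] qmin hD hR.
have [phi hphi] := clears_hom hp.
have [h hh hE] := length_image hphi pq hD hR; exists h => //.
split; first by exists phi.
move=> psi l hl; have [p' hp'] := hom_scaled_delta psi.
have [p0|p0] := eqVneq p' 0.
  by rewrite p0 in hp'; case: (zero_image_length hp' hl).
have [q' pq'] := fps_order_ex p0.
have := qmin _ _ (scales_delta_clears hp') pq'.
have [l' /has_length_uniq/(_ hl) ->] := length_image hp' pq' hD hR.
by lia.
Qed.

(** * A non-trivial torsion element *)

Lemma mordge_maxideal_sq F : F \in maxideal_sq n k -> mordge 2 F.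
Proof.
move/asboolP=> [a ->] M M2; rewrite mfpscoef_sum big1 // => ij _.
apply: (@mordgeM n k 0 2) => //.
by apply: (@mordgeM n k 1 1); apply: mordge_X.
Qed.

(** If X_i dX_l - X_l dX_i - dF were congruent modulo I to a combination
    sum_j A_j df_j, its exterior derivative would vanish at the origin, because
    all the elements of I have order at least 2: both d(A_j df_j) = dA_j df_j
    and the derivatives of elements of I vanish there. But d dF = 0, and the
    exterior derivative of X_i dX_l - X_l dX_i is 2 dX_i dX_l. *)
Lemma rotation_not_exact (i l : 'I_n) F :
  {subset gen_ideal f <= maxideal_sq n k} -> i != l ->
  \row_s pi (mfps_X k i *+ (s == l) - mfps_X k l *+ (s == i)
             - mfps_deriv s F) \notin genmod (diff_row pi f).
Proof.
move=> I_sub il; apply/asboolPn => -[a /rowP ha].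
pose A j := sval (cid (pi_surj (a j))).
have AE j : pi (A j) = a j by rewrite /A; case: cid.
pose g s := mfps_X k i *+ (s == l) - mfps_X k l *+ (s == i)
   - mfps_deriv s F - \sum_j A j * mfps_deriv s (f j).
(* g s, the coordinate of the difference on dX_s, lies in I. *)
have g2 s : mordge 2 (g s).
  apply/mordge_maxideal_sq/I_sub/pi_ker.
  have hs := ha s; rewrite mxE summxE in hs.
  rewrite rmorphB hs rmorph_sum; apply/eqP; rewrite subr_eq0; apply/eqP.
  by apply: eq_bigr => j _; rewrite !mxE rmorphM AE.
pose ev (G : mfps n k) := mfpscoef G 0%MM.
have ev_deriv (G : mfps n k) s : mordge 2 G -> ev (mfps_deriv s G) = 0.
  by move=> hG; apply: (mfps_deriv_mordge s hG); rewrite mdeg0.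
have f2 j : mordge 2 (f j).
  apply/mordge_maxideal_sq/I_sub; exact: (@genmod_mem _ (mfps n k)^o).
have evM G H : ev (G * H) = ev G * ev H by apply: mfpscoef0M.
have ev_dg s u : ev (mfps_deriv u (g s)) =
    ((u == i) && (s == l))%:R - ((u == l) && (s == i))%:R
    - ev (mfps_deriv u (mfps_deriv s F))
    - \sum_j ev (A j) * ev (mfps_deriv u (mfps_deriv s (f j))).
  have dB := derivation_alongB (mfps_deriv_derivation k u).
  have evX (b : bool) v : ev (mfps_deriv u (mfps_X k v *+ b)) = ((u == v) && b)%:R.
    case: b.
      by rewrite mulr1n andbT mfps_deriv_X; case: (u == v); rewrite /ev /= ?eqxx.
    rewrite mulr0n andbF (derivation_along0 (mfps_deriv_derivation k u)).
    exact: mfpscoef0.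
  rewrite /g !dB (derivation_along_sum (mfps_deriv_derivation k u)).
  rewrite -[ev (_ - _)]/(ev _ - ev _) -[ev (_ - _)]/(ev _ - ev _).
  rewrite -[ev (_ - _)]/(ev _ - ev _) !evX; congr (_ - _).
  rewrite /ev mfpscoef_sum; apply: eq_bigr => j _.
  rewrite mfps_derivM -[LHS]/(ev _ + ev _) !evM.
  by rewrite (ev_deriv (f j) s (f2 j)) mul0r addr0.
have evg s u : ev (mfps_deriv u (g s)) = 0 := ev_deriv (g s) u (g2 s).
have comm G : ev (mfps_deriv l (mfps_deriv i G)) = ev (mfps_deriv i (mfps_deriv l G)).
  by apply: mfps_deriv_comm0; rewrite eq_sym.
(* The two mixed derivatives d_i (g l) and d_l (g i) differ by 2. *)
have e1 := ev_dg i l; have e2 := ev_dg l i.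
rewrite evg !eqxx [l == i]eq_sym (negbTE il) comm in e1.
rewrite (eq_bigr _ (fun j _ => congr1 ( *%R (ev (A j))) (comm (f j)))) in e1.
rewrite evg !eqxx (negbTE il) in e2.
have : (2%:R : k) == 0.
  have e := congr2 (fun a b : k => a - b) e2 e1; rewrite subrr in e.
  by apply/eqP; rewrite [RHS]e andbT andbF andFb mulr0n mulr1n; ring.
by apply/negP/pchar0_natr_neq0.
Qed.

(** If D consists of derivatives of elements of R, then x_i x_l' - x_l x_i' is
    the derivative of some r, and w = X_i dX_l - X_l dX_i - dr is killed by
    Omega -> D without being zero. *)
Lemma exact_torsion :
  (2 <= n)%N -> {subset gen_ideal f <= maxideal_sq n k} ->
  (forall y, (y : restr iota) \in D -> exists r, fps_deriv (iota r) = y) ->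
  exists2 w : Om, torsion w & w != 0.
Proof.
move=> n2 I_sub exact_D.
pose i : 'I_n := Ordinal (ltnW n2); pose l : 'I_n := Ordinal n2.
have il : i != l by [].
pose y := param pi iota i * x' l - param pi iota l * x' i.
have pick G s : \sum_u iota (pi (G *+ (u == s))) * x' u = iota (pi G) * x' s.
  rewrite (bigD1 s) //= eqxx big1 ?addr0 // => u /negbTE ->.
  by rewrite mulr0n !rmorph0 mul0r.
have yE : y = \sum_s
    iota (pi (mfps_X k i *+ (s == l) - mfps_X k l *+ (s == i))) * x' s.
  rewrite /y /param -!pick -sumrB; apply: eq_bigr => s _.
  by rewrite !rmorphB mulrBl.
have yD : (y : restr iota) \in D.
  by apply/derivmodP; eexists; exact: yE.
have [r ry] := exact_D y yD; have [F Fr] := pi_surj r.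
set v := \row_s pi (mfps_X k i *+ (s == l) - mfps_X k l *+ (s == i) - mfps_deriv s F).
exists (proj v); last first.
  by apply/eqP => /quotmod_pi_eq0; apply/negP/rotation_not_exact.
apply: delta_kernel_torsion.
transitivity (y - fps_deriv (iota (pi F))); last by rewrite Fr ry subrr.
rewrite (subst_chain_rule k_char0 (sigma := sigma) iota_const F) yE -sumrB.
by apply: eq_bigr => s _; rewrite mxE !rmorphB mulrBl.
Qed.

End Conductor.
End Branch.

(** * The formula for h and the torsion of Omega *)

Theorem theorem5p2
  (k : closedFieldType) (k_char0 : [pchar k] =i pred0)
  (n : nat) (n_ge2 : (2 <= n)%N)
  (* R = k[[X_1, ..., X_n]] / I, with I = (f_1, ..., f_m) *)
  (m : nat) (f : 'I_m -> mfps n k)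
  (R : idomainType) (pi : {rmorphism mfps n k -> R})
  (pi_surj : forall r : R, exists F : mfps n k, pi F = r)
  (pi_ker : forall F : mfps n k, pi F = 0 <-> F \in gen_ideal f)
  (R_dim1 : has_krull_dim R 1)
  (I_sub : {subset gen_ideal f <= maxideal_sq n k})
  (* iota is the inclusion of k-algebras of R in its integral closure k[[t]],
     and k((t)) is the fraction field of R *)
  (iota : {rmorphism R -> fps k}) (iota_inj : injective iota)
  (iota_const : forall c : k, iota (pi (mfps_const n c)) = fps_const c)
  (frac_R : forall z : laurent k, exists a b : R,
      b != 0 /\ z = tofrac (iota a) / tofrac (iota b))
  (closure_R : forall z : laurent k,
      integralOver (fun r : R => tofrac (iota r)) z <->
      exists y : fps k, z = tofrac y) :
  exists (h lenD lenR : nat) (vD : int),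
    [/\ h_inv (Omega pi f) h,
        has_length (quotmod (derivmod pi iota)) lenD,
        has_length (quotmod (image_mod (restr_incl iota))) lenR
      & min_val (derivmod_inv pi iota) vD] /\
    [/\ h%:Z = lenD%:Z - lenR%:Z + vD,
        lenD%:Z - lenR%:Z + vD <= vD
      & lenD%:Z - lenR%:Z + vD = vD ->
        exists2 w : Omega pi f, torsion w & w != 0].
Proof.
have [c conductor] := branch_conductor k_char0 pi_surj iota_inj iota_const frac_R.
have [q [qex qmin]] := clears_min pi conductor.
have hD := length_derivmod k_char0 pi_surj iota_const conductor (leqnn c).
have hR := length_closure iota_const conductor (leqnn c).
set lenD := (c - _)%N in hD; set lenR := (c - _)%N in hR.
have lDR := length_derivmod_le k_char0 pi_surj iota_const conductor hD hR.
have [h hh hE] := h_inv_Omega k_char0 pi_surj pi_ker iota_inj iota_const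
  conductor qex qmin hD hR.
exists h, lenD, lenR, (q%:Z - c%:Z); split; split => //.
- exact: (min_val_derivmod_inv k_char0 pi_surj pi_ker iota_inj iota_const
    conductor qex qmin).
- lia.
move=> E; have lE : lenD = lenR by lia.
rewrite lE in hD.
apply: (exact_torsion k_char0 pi_surj pi_ker iota_inj iota_const frac_R conductor
  n_ge2 I_sub).
exact: (derivmod_exact k_char0 pi_surj iota_const conductor hD hR).
Qed.
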